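(* Assume the Hardy-Littlewood Conjecture. Let $\alpha$ be an integer with $\alpha\equiv 1\pmod 4$ and let $D=\pm 2^\sigma p_1\cdots p_r(q_1\cdots q_s)^2(l_1\cdots l_t)^3$ be as in the context, with $\gcd(D,\alpha)=1$ and $4\parallel D$. If $\frac D4\equiv 3\pmod 4$, then $$\mathrm{dens}_D(2\alpha)=\frac14\left(1+\frac{(-1)^{r+t}}{\tau(p_1\cdots p_rl_1\cdots l_t)}+\frac{2(-1)^{r_1+r_7+s+t_1+t_7}}{\tau(p_1\cdots p_rq_1\cdots q_sl_1\cdots l_t)}\right),$$ $$\mathrm{dens}_D(-2\alpha)=\frac14\left(1+\frac{(-1)^{r+t}}{\tau(p_1\cdots p_rl_1\cdots l_t)}-\frac{2(-1)^{r_1+r_7+s+t_1+t_7}}{\tau(p_1\cdots p_rq_1\cdots q_sl_1\cdots l_t)}\right).$$ If $\frac D4\equiv 1\pmod 4$, then $$\mathrm{dens}_D(2\alpha)=\mathrm{dens}_D(-2\alpha)=\frac14\left(1+\frac{(-1)^{r+t}}{\tau(p_1\cdots p_rl_1\cdots l_t)}\right).$$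
   Context: $D=\pm 2^\sigma p_1\cdots p_r(q_1\cdots q_s)^2(l_1\cdots l_t)^3$ with $\sigma\in\{0,1,2,3\}$, $r,s,t\ge0$, and the $p_i,q_i,l_i$ pairwise distinct odd primes. $r_i$ is the number of primes among $p_1,\dots,p_r$ congruent to $i$ mod $8$, and $t_i$ the number of primes among $l_1,\dots,l_t$ congruent to $i$ mod $8$. On odd squarefree positive integers, $\tau(n)=\prod_{l\mid n}\tau(l)$ with $\tau(l)=l$ if $l\equiv3\pmod4$, $\tau(l)=l-2$ if $l\equiv1\pmod4$, and $\tau(1)=1$. $2^k\parallel D$ means $2^k\mid D$ and $2^{k+1}\nmid D$. For a nonzero integer $D$, $E_D$ is the elliptic curve $y^2=x^3+Dx$, and for a prime $p\nmid 2D$, $a_p(E_D)=1+p-\#\tilde E_D(\mathbb{F}_p)$. For a nonzero integer $m$ put $Q(m,N)=\{p \text{ prime}: p=m^2+x^2\le N \text{ for some } x\in\mathbb{Z}\}$ and $$\mathrm{dens}_D(2m)=\lim_{N\to\infty}\frac{\#\{p\in Q(m,N): p\nmid 2D,\ a_p(E_D)=2m\}}{\#Q(m,N)}$$ (denoted $a_p(2m)$ in the paper); the claim includes that the limits exist. Hardy-Littlewood Conjecture: for all integers $a,b,c$ with $a>0$, $\gcd(a,b,c)=1$, $a+b$ and $c$ not both even, and $\Delta=b^2-4ac$ not a perfect square, the number $P(n)$ of primes less than $n$ of the form $ax^2+bx+c$ (with $x$ a nonnegative integer) satisfies $P(n)\sim\delta(a,b,c)\frac{\sqrt{n}}{\log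 n}$ as $n\to\infty$, where $$\delta(a,b,c)=\frac{\gcd(2,a+b)}{\sqrt{a}}\prod_{p\mid a,\ p\mid b,\ p>2}\frac{p}{p-1}\ \prod_{p\nmid a,\ p>2}\left(1-\frac{\left(\frac{\Delta}{p}\right)}{p-1}\right),$$ the products being over primes (the second taken in increasing order of $p$) and $\left(\frac{\cdot}{p}\right)$ being the Legendre symbol. *)

(* Defs.v *)
From mathcomp Require Import all_boot all_order all_algebra.
From mathcomp Require Import all_classical all_reals all_analysis.

Set Implicit Arguments.
Unset Strict Implicit.
Unset Printing Implicit Defensive.

Import Order.TTheory GRing.Theory Num.Theory.
Import numFieldNormedType.Exports.

Local Open Scope ring_scope.

Definition legendre (a : int) (p : nat) : int :=
  if (p %| a)%Z then 0
  else if [exists x : 'I_p, (x%:Z ^+ 2 == a %[mod p])%Z] then 1 else -1.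

Definition HL_count (a b c : int) (n : nat) : nat :=
  #|[set p : 'I_n | prime p &&
      `[< exists x : nat, p%:Z = a * x%:Z ^+ 2 + b * x%:Z + c >]]%SET|.

Definition HL_delta (R : realType) (a b c : int) : R :=
  (gcdz 2 (a + b))%:~R / Num.sqrt a%:~R
  * (\prod_(p <- primes `|a|%N | (p%:Z %| b)%Z && (2 < p)%N)
       (p%:R / (p%:R - 1)))
  * limn (fun n : nat => \prod_(3 <= p < n | prime p && ~~ (p%:Z %| a)%Z)
       (1 - (legendre (b ^+ 2 - 4 * a * c) p)%:~R / (p%:R - 1)) : R).

(* The asymptotic equivalence is stated as "the quotient tends to 1". Since
   [x / 0 = 0] and [limn] of a divergent real sequence is 0, this fails when
   the infinite product in [HL_delta] diverges (or is 0). *)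
Definition Hardy_Littlewood (R : realType) : Prop :=
  forall a b c : int,
    0 < a -> gcdz (gcdz a b) c = 1 ->
    ~ ((2 %| a + b)%Z /\ (2 %| c)%Z) ->
    ~ (exists k : int, b ^+ 2 - 4 * a * c = k ^+ 2) ->
    ((fun n : nat => (HL_count a b c n)%:R /
        (HL_delta R a b c * (Num.sqrt n%:R / ln n%:R))) @ \oo --> (1 : R))%classic.

(* Affine points of [y ^ 2 = x ^ 3 + D x] over ['F_p], plus the point at
   infinity; meant for a prime [p] not dividing [2 D]. *)
Definition E_points (D : int) (p : nat) : nat :=
  #|[set P : 'F_p * 'F_p | P.2 ^+ 2 == P.1 ^+ 3 + D%:~R * P.1]%SET|.+1.

Definition E_trace (D : int) (p : nat) : int := 1 + p%:Z - (E_points D p)%:Z.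

Definition Q (m : int) (N : nat) : {set 'I_N.+1} :=
  [set p : 'I_N.+1 | prime p &&
     `[< exists x : int, p%:Z = m ^+ 2 + x ^+ 2 >]]%SET.

(* [has_dens D m d] : the limit dens_D(2m) exists and equals [d]. *)
Definition has_dens (R : realType) (D m : int) (d : R) : Prop :=
  ((fun N : nat =>
      #|[set p in Q m N | ~~ (p%:Z %| 2 * D)%Z &&
                          (E_trace D p == 2 * m)]%SET|%:R / #|Q m N|%:R)
     @ \oo --> d)%classic.

(* Meant for [n] odd, squarefree and positive. *)
Definition tau (n : nat) : nat :=
  \prod_(l <- primes n) (if l == 3 %[mod 4] then l else (l - 2)%N).

(* The number of members of [s] congruent to [i] mod 8. *)
Definition count8 (i : nat) (s : seq nat) : nat :=
  count (fun p => p == i %[mod 8]) s.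

(* Main.v *)
Require Import Defs.
From mathcomp Require Import all_boot all_order all_algebra.
From mathcomp Require Import cyclic closed_field finfield algC cyclotomic.
From mathcomp Require Import all_classical all_reals all_analysis.
From mathcomp Require Import ring lra zify.

Set Implicit Arguments.
Unset Strict Implicit.
Unset Printing Implicit Defensive.

Import Order.TTheory GRing.Theory Num.Theory.
Import numFieldNormedType.Exports.

Local Open Scope ring_scope.

(** Write D = 4 d with d odd. A prime p = alpha ^ 2 + x ^ 2 that does not
    divide 2 D has x even and p = 1 modulo 4, and the curve y ^ 2 = x ^ 3 +
    D x is birational over F_p to s ^ 2 = w ^ 4 - d. Expanding the number of
    points of the latter in characters gives the trace of Frobenius as -
    (conj (chi d) J + chi d conj J), where chi is a quartic character modulo
    p and J the Jacobi sum of chi and the quadratic character ([trace_eq]).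
    The Jacobi sum has norm p and is primary ([jac_norm_Fp], [jac_primary]).
    As p is a sum of two squares in only one way, J is determined by alpha
    and x up to conjugation, and the trace is 2 alpha or - 2 alpha exactly
    when chi d is a certain sign depending on x modulo 4
    ([trace_criterion]).

    Quartic reciprocity turns chi d into a function of x. Up to a power of
    chi (-1), the number d is a product of primary primes, l or - l, and for
    each of these the Gauss sum of chi, computed in a field of
    characteristic l and raised to the power l by Frobenius, expresses chi
    (l) or chi (- l) through J modulo l ([reciprocity1], [reciprocity3]).
    This gives an exponent modulo 4 that depends only on x modulo l
    ([local_symbol]). The condition on the trace is therefore a condition on
    x modulo M = 4 l_1 ... l_n, where the l_i are the odd primes dividing D
    ([trace_symbol]).

    The conjecture applied to the polynomials (M y + c) ^ 2 + alpha ^ 2 and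
    y ^ 2 + alpha ^ 2 shows that the primes alpha ^ 2 + x ^ 2 are
    equidistributed over the even classes c modulo M for which c ^ 2 + alpha
    ^ 2 is prime to M: the two infinite products differ by finitely many
    factors, and the quotient of the constants is the inverse of the number
    of such classes, which is 2 tau (l_1 ... l_n) ([delta_ratio]). These
    products converge to a nonzero limit because the conjecture would
    otherwise compare the prime count with 0.

    It remains to count the classes c whose symbol is 0 or 2 modulo 4.
    Orthogonality of the characters of Z / 4 and the Chinese remainder
    theorem reduce this to the sums of 'i ^ (j k) over the classes modulo a
    single l, where k is the local symbol ([symbol_sum]). These reduce to
    complete character sums, with value tau (l) for j = 0 and -1 for j = 2,
    while for odd j the value is -1 if l is 1 or 7 modulo 8 and 1 otherwise.
    In the symbol of d a prime of exponent e carries the multiple e k, so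
    the terms j = 0, 2 and j = 1, 3 of the orthogonality relation are, in
    this order, the three terms of the formula. *)

(** * Multiplicative characters, Gauss and Jacobi sums over a finite field *)

Section MulChar.
Variables (F : finFieldType) (L : fieldType).
Implicit Types f h : F -> L.

(** Characters are extended by 0 at 0, the trivial one included, so that products
    and inverses of values are again characters. *)
Definition mul_char f := [/\ f 0 = 0, f 1 = 1 & {morph f : x y / x * y}].

Definition nontrivial f := exists2 a, a != 0 & f a != 1.

Lemma mul_charV f x : mul_char f -> f x^-1 = (f x)^-1.
Proof.
move=> [f0 f1 fM]; have [->|x0] := eqVneq x 0; first by rewrite invr0 f0 invr0.
have h : f x^-1 * f x = 1 by rewrite -fM mulVf.
have fx0 : f x != 0 by apply: contra_eq_neq h => ->; rewrite mulr0 eq_sym oner_eq0.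
by apply: (mulIf fx0); rewrite h mulVf.
Qed.

Lemma mul_char_neq0 f x : mul_char f -> x != 0 -> f x != 0.
Proof.
move=> [f0 f1 fM] x0; have h : f x^-1 * f x = 1 by rewrite -fM mulVf.
by apply: contra_eq_neq h => ->; rewrite mulr0 eq_sym oner_eq0.
Qed.

Lemma mul_charM f h : mul_char f -> mul_char h -> mul_char (fun x => f x * h x).
Proof.
move=> [f0 f1 fM] [h0 h1 hM]; split; rewrite ?f0 ?f1 ?h1 ?mul0r ?mulr1 //.
by move=> x y; rewrite fM hM mulrACA.
Qed.

Lemma sum_nontrivial f : mul_char f -> nontrivial f -> \sum_x f x = 0.
Proof.
move=> [f0 f1 fM] [a a0 fa].
have e : \sum_x f x = f a * \sum_x f x.
  rewrite mulr_sumr (reindex (fun x => a * x)) /=; last first.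
    by exists (fun x => a^-1 * x) => x _; rewrite mulrA ?mulVf ?divff ?mul1r.
  by apply: eq_bigr => x _; rewrite fM.
apply/eqP; have /eqP : (f a - 1) * \sum_x f x = 0 by rewrite mulrBl -e mul1r subrr.
by rewrite mulf_eq0 subr_eq0 (negPf fa).
Qed.

(** The map v |-> v / (1 - v) turns this Jacobi sum into a sum of f over
    everything except -1. *)
Lemma jacobi_inv f : mul_char f -> nontrivial f ->
  \sum_v f v / f (1 - v) = - f (-1).
Proof.
move=> fc fn; have [f0 f1 fM] := fc.
rewrite (bigD1 1) //= subrr f0 invr0 mulr0 add0r.
have e : \sum_x f x = f (-1) + \sum_(t | t != -1) f t by rewrite (bigD1 (-1)).
have -> : - f (-1) = \sum_(t | t != -1) f t.
  by apply/eqP; rewrite eq_sym -addr_eq0 addrC -e (sum_nontrivial fc).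
rewrite [RHS](reindex_onto (fun v : F => v / (1 - v)) (fun t => t / (1 + t))) /=; last first.
  move=> t ht; have h1 : 1 + t != 0 by rewrite addrC addr_eq0.
  by field; rewrite h1 /= addrK oner_eq0.
apply: eq_big => v; last by move=> _; rewrite fM mul_charV.
have [->|hv] := eqVneq v 1.
  rewrite subrr invr0 mulr0 mul0r.
  by rewrite (eq_sym 0 1) oner_eq0 andbF.
have h1 : 1 - v != 0 by rewrite subr_eq0 eq_sym.
have h2 : 1 + v / (1 - v) = (1 - v)^-1 by field.
rewrite h2 invrK divfK // eqxx andbT; apply/esym.
rewrite -(inj_eq (mulIf h1)) divfK // mulN1r opprB -subr_eq0 opprB addrC subrK.
exact: oner_neq0.
Qed.

Section Gauss.
Variable e : F -> L.
Hypotheses (eD : forall x y, e (x + y) = e x * e y) (e0 : e 0 = 1)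
  (sum_e : \sum_x e x = 0).

Definition gauss f := \sum_x f x * e x.
Definition jacobi f h := \sum_v f v * h (1 - v).

(** The double sum is grouped by the value u of the argument of the additive
    character; u = 0 gives the first term, and rescaling by u the second. *)
Lemma gaussMgauss f h : mul_char f -> mul_char h ->
  gauss f * gauss h =
    h (-1) * (\sum_x f x * h x)
    + jacobi f h * (\sum_(u | u != 0) f u * h u * e u).
Proof.
move=> [f0 f1 fM] [h0 h1 hM].
have -> : gauss f * gauss h = \sum_u (\sum_s f s * h (u - s)) * e u.
  under [RHS]eq_bigr do rewrite mulr_suml.
  rewrite exchange_big /= /gauss mulr_suml; apply: eq_bigr => s _.
  rewrite mulr_sumr (reindex (fun u => u - s)) /=; last first.
    by exists (fun u => u + s) => u _; rewrite ?addrK ?subrK.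
  apply: eq_bigr => u _; have -> : e u = e s * e (u - s) by rewrite -eD addrC subrK.
  by ring.
rewrite (bigD1 0) //= e0 mulr1; congr (_ + _).
  rewrite mulr_sumr; apply: eq_bigr => s _.
  have -> : h (0 - s) = h (-1) * h s by rewrite -hM mulN1r sub0r.
  by ring.
rewrite mulr_sumr; apply: eq_bigr => u u0.
rewrite mulrA; congr (_ * _); rewrite /jacobi mulr_suml.
rewrite (reindex (fun s => u * s)) /=; last first.
  by exists (fun x => u^-1 * x) => x _; rewrite mulrA ?mulVf ?divff ?mul1r.
apply: eq_bigr => s _; have -> : u - u * s = u * (1 - s) by ring.
by rewrite fM hM; ring.
Qed.

Lemma gauss_jacobi f h : mul_char f -> mul_char h ->
  nontrivial (fun x => f x * h x) ->
  gauss f * gauss h = jacobi f h * gauss (fun x => f x * h x).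
Proof.
move=> fc hc nt; rewrite gaussMgauss // sum_nontrivial //; last exact: mul_charM.
rewrite mulr0 add0r; congr (_ * _); rewrite /gauss [RHS](bigD1 0) //=.
by have [f0 _ _] := fc; rewrite f0 !mul0r add0r.
Qed.

(** For a character and its inverse the Jacobi sum is - f (-1), so both terms of
    [gaussMgauss] are explicit. *)
Lemma gauss_inv f h : mul_char f -> mul_char h -> nontrivial f ->
  (forall x, h x = (f x)^-1) -> gauss f * gauss h = f (-1) * #|F|%:R.
Proof.
move=> fc hc nt hE; rewrite gaussMgauss //.
have -> : jacobi f h = - f (-1).
  by rewrite -(jacobi_inv fc nt); apply: eq_bigr => v _; rewrite hE.
have -> : \sum_(u | u != 0) f u * h u * e u = -1.
  under eq_bigr => u u0 do rewrite hE divff ?mul1r ?mul_char_neq0 //.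
  by apply/eqP; rewrite -addr_eq0 -e0 addrC; move: sum_e; rewrite (bigD1 0) //= => ->.
have -> : \sum_x f x * h x = #|F|%:R - 1.
  rewrite (bigD1 0) //=; have [f0 _ _] := fc; rewrite f0 mul0r add0r.
  under eq_bigr => u u0 do rewrite hE divff ?mul_char_neq0 //.
  by rewrite -[in RHS]sum1_card natr_sum [in RHS](bigD1 0) //= addrAC subrr add0r.
have -> : h (-1) = f (-1).
  by rewrite hE -mul_charV // invrN1.
ring.
Qed.
End Gauss.
End MulChar.

(** * Discrete logarithms in finite fields *)

Lemma exists_primitive_root (F : finFieldType) :
  exists g : F, (#|F|.-1).-primitive_root g.
Proof.
have cardF : (#|F|.-1 > 0)%N by move: (finNzRing_gt1 F); case: #|_| => [|[|?]].
have : has (#|F|.-1).-primitive_root (enum [pred x : F | x != 0]).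
  apply: has_prim_root => //; last 1 first.
  - by rewrite -cardE cardC1.
  - apply/allP => x; rewrite mem_enum inE => x0; apply/unity_rootP.
    apply: (mulIf x0); rewrite mul1r -exprSr prednK ?expf_card //.
    by apply: ltnW; exact: finNzRing_gt1.
  - exact: enum_uniq.
by case/hasP => g _ gP; exists g.
Qed.

Lemma prim_root_neq0 (L : fieldType) n (z : L) : n.-primitive_root z -> z != 0.
Proof. by move=> zP; rewrite (prim_root_eq0 zP) -lt0n (prim_order_gt0 zP). Qed.

Lemma prim_root_half (L : fieldType) n (z : L) :
  n.-primitive_root z -> (2 %| n)%N -> z ^+ (n %/ 2) = -1.
Proof.
move=> zP even; have n0 := prim_order_gt0 zP.
have : (z ^+ (n %/ 2)) ^+ 2 == 1 by rewrite -exprM divnK // prim_expr_order.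
rewrite sqrf_eq1 => /orP [|/eqP //].
by rewrite -(prim_order_dvd zP) => /dvdn_leq; lia.
Qed.

(** The value at 0 is a dummy; characters are set to 0 there. *)
Definition dlog (F : finFieldType) (g x : F) : nat :=
  if [pick i : 'I_#|F|.-1 | x == g ^+ i] is Some i then i else 0%N.

Section DiscreteLog.
Variables (F : finFieldType) (g : F).
Hypothesis gP : (#|F|.-1).-primitive_root g.

Lemma prim_neq0 : g != 0.
Proof. exact: prim_root_neq0 gP. Qed.

Lemma dlogK x : x != 0 -> g ^+ dlog g x = x.
Proof.
move=> x0; rewrite /dlog; case: pickP => [i /eqP -> //|no].
have [|i xE] := prim_rootP gP (x := x); last by have := no i; rewrite xE eqxx.
apply: (mulIf x0); rewrite mul1r -exprSr prednK ?expf_card //.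
by apply: ltnW; exact: finNzRing_gt1.
Qed.

Lemma dlog_expr n : dlog g (g ^+ n) = n %[mod #|F|.-1].
Proof.
by apply/eqP; rewrite -(eq_prim_root_expr gP) dlogK // expf_neq0 // prim_neq0.
Qed.

Lemma dlogM x y : x != 0 -> y != 0 ->
  dlog g (x * y) = (dlog g x + dlog g y)%N %[mod #|F|.-1].
Proof.
by move=> x0 y0; rewrite -{1}(dlogK x0) -{1}(dlogK y0) -exprD dlog_expr.
Qed.

Lemma dlogX x n : x != 0 -> dlog g (x ^+ n) = (n * dlog g x)%N %[mod #|F|.-1].
Proof.
by move=> x0; rewrite -{1}(dlogK x0) -exprM dlog_expr mulnC.
Qed.

Lemma dlog1 : dlog g 1 = 0 %[mod #|F|.-1].
Proof. by rewrite -(expr0 g) dlog_expr. Qed.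

Lemma dlogN1 : (2 %| #|F|.-1)%N -> dlog g (-1) = (#|F|.-1 %/ 2)%N %[mod #|F|.-1].
Proof. by move=> even; rewrite -(prim_root_half gP even) dlog_expr. Qed.

Lemma sum_units (V : zmodType) (f : F -> V) :
  \sum_(x | x != 0) f x = \sum_(i < #|F|.-1) f (g ^+ i).
Proof.
rewrite (reindex_omap (fun i : 'I_#|F|.-1 => g ^+ i)
  (fun x => [pick i : 'I_#|F|.-1 | x == g ^+ i])) /=; last first.
  move=> x x0; case: pickP => [i /eqP -> //|no].
  have := no (Ordinal (ltn_pmod (dlog g x) (prim_order_gt0 gP))).
  by rewrite /= (prim_expr_mod gP) dlogK // eqxx.
apply: eq_bigl => i; rewrite expf_neq0 ?prim_neq0 //=.
case: pickP => [j|/(_ i)]; last by rewrite eqxx.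
rewrite (eq_prim_root_expr gP) !modn_small // => /eqP ij.
by apply/eqP; congr Some; apply: val_inj.
Qed.

(** The d-th powers are the elements whose logarithm is divisible by d, and the
    nonzero ones have d preimages each. *)
Lemma sum_power (V : zmodType) (f : F -> V) d : (0 < d)%N -> (d %| #|F|.-1)%N ->
  \sum_w f (w ^+ d) =
  \sum_u f u *+ (if u == 0 then 1%N else if (d %| dlog g u)%N then d else 0%N).
Proof.
move=> d0 dN; rewrite (bigD1 0) //= [RHS](bigD1 0) //= eqxx expr0n gtn_eqF //=.
congr (_ + _); rewrite !sum_units.
under [RHS]eq_bigr => i _.
  rewrite (negPf (expf_neq0 _ prim_neq0)).
  have -> : (d %| dlog g (g ^+ i))%N = (d %| i)%N.
    have /(congr1 (modn^~ d)) := dlog_expr i; rewrite !modn_dvdm // => h.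
    by rewrite /dvdn h.
  over.
have NE : #|F|.-1 = (#|F|.-1 %/ d * d)%N by rewrite divnK.
set n := (#|F|.-1 %/ d)%N in NE *; have gN := prim_expr_order gP.
(* both sides are d times the sum over one period of i |-> f (g ^ (d i)) *)
pose h i := f (g ^+ (d * i)).
have hper k i : h (k * n + i)%N = h i.
  rewrite /h mulnDr exprD (_ : (d * (k * n) = #|F|.-1 * k)%N); last by rewrite NE; ring.
  by rewrite exprM gN expr1n mul1r.
transitivity ((\sum_(i < n) h i) *+ d).
  under eq_bigr do rewrite -exprM mulnC.
  rewrite -(big_mkord xpredT h) {1}NE mulnC.
  elim: {1 2}d => [|k IH]; first by rewrite mul0n big_geq ?mulr0n.
  rewrite mulSn addnC (big_cat_nat (n := (k * n)%N)) ?leq_addr //= IH mulrSr.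
  congr (_ + _); rewrite -{1}[(k * n)%N]add0n [(k * n + n)%N]addnC big_addn addnK.
  by rewrite big_mkord; apply: eq_bigr => i _; rewrite addnC hper.
rewrite -(big_mkord xpredT (fun i => f (g ^+ i) *+ (if (d %| i)%N then d else 0%N))).
rewrite NE /h {h hper NE}; elim: n => [|k IH]; first by rewrite mul0n big_ord0 big_geq // mul0rn.
rewrite mulSn addnC (big_cat_nat (n := (k * d)%N)) ?leq_addr //= -IH.
rewrite big_ord_recr /= mulrnDl; congr (_ + _).
rewrite big_ltn; last lia.
rewrite dvdn_mull // [(k * d)%N]mulnC big1_seq ?addr0 // => i.
rewrite mem_index_iota => /andP [_ /andP [h1 h2]].
case: ifP => // /dvdnP [c ic]; by move: h1 h2; rewrite ic [(d * k)%N]mulnC ltn_pmul2r // addnC -mulSn ltn_pmul2r //; lia.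
Qed.
End DiscreteLog.

(** * Quartic characters *)

(** The j-th power of the quartic character that sends the primitive root g to
    the fourth root of unity I.  The field of values L is arbitrary: characters
    with values in algC serve to count points, and characters with values in
    characteristic l serve to prove reciprocity. *)
Definition chi (F : finFieldType) (L : fieldType) (g : F) (I : L) (j : nat) (x : F) : L :=
  if x == 0 then 0 else I ^+ (j * dlog g x).

(** Real and imaginary part of the n-th power of the imaginary unit. *)
Definition re4 (n : nat) : int :=
  match (n %% 4)%N with 0 => 1 | 2 => -1 | _ => 0 end.
Definition im4 (n : nat) : int :=
  match (n %% 4)%N with 1 => 1 | 3 => -1 | _ => 0 end.

Lemma mod4_cases n : [\/ n %% 4 = 0, n %% 4 = 1, n %% 4 = 2 | n %% 4 = 3]%N.
Proof.
have : (n %% 4 < 4)%N by rewrite ltn_mod.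
by case: (n %% 4)%N => [|[|[|[|]]]] // _; [apply: Or41|apply: Or42|apply: Or43|apply: Or44].
Qed.

Section FourthRoot.
Variables (L : fieldType) (I : L).
Hypothesis IP : 4.-primitive_root I.

Lemma sqr_prim4 : I ^+ 2 = -1.
Proof. exact: (prim_root_half IP). Qed.

Lemma expr_re_im n : I ^+ n = (re4 n)%:~R + (im4 n)%:~R * I.
Proof.
rewrite -(prim_expr_mod IP) /re4 /im4; have I2 := sqr_prim4.
case: (mod4_cases n) => -> /=; rewrite ?(exprSr _ 2) ?I2 ?expr1 ?expr0; ring.
Qed.

Lemma prim4N : 4.-primitive_root (- I).
Proof.
have -> : - I = I ^+ 3 by rewrite (exprSr _ 2) sqr_prim4 mulN1r.
by rewrite (prim_root_exp_coprime _ IP).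
Qed.

Lemma prim4_eq1 n : (I ^+ n == 1) = (4 %| n)%N.
Proof. by rewrite -(prim_order_dvd IP). Qed.

Lemma two_neq0 : (2 : L) != 0.
Proof. exact: (prim_root_dvd_eq0 IP (m := 2)). Qed.
End FourthRoot.

Lemma sqr_is_prim4 (L : fieldType) (I : L) :
  I ^+ 2 = -1 -> (2 : L) != 0 -> 4.-primitive_root I.
Proof.
move=> I2 two; have I4 : I ^+ 4 = 1 by rewrite (exprM _ 2 2) I2 sqrrN expr1n.
have [m mP] := prim_order_exists (isT : 0 < 4)%N I4.
case: m mP => [|[|[|[|[|m]]]]] mP //.
  have := prim_expr_order mP; rewrite expr1 => I1 _; move: I2.
  rewrite I1 expr1n => /eqP; rewrite -subr_eq0 opprK -[1 + 1]/(2%:R).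
  by rewrite (negPf two).
have := prim_expr_order mP; rewrite I2 => /eqP; rewrite eq_sym -subr_eq0 opprK.
by rewrite -[1 + 1]/(2%:R) (negPf two).
Qed.

Section Quartic.
Variables (F : finFieldType) (g : F).
Hypotheses (gP : (#|F|.-1).-primitive_root g) (h4 : (4 %| #|F|.-1)%N).

Lemma dlogM4 x y : x != 0 -> y != 0 ->
  dlog g (x * y) = (dlog g x + dlog g y)%N %[mod 4].
Proof.
move=> x0 y0; have /(congr1 (modn^~ 4)) := dlogM gP x0 y0.
by rewrite !modn_dvdm.
Qed.

Lemma dlogX4 x n : x != 0 -> dlog g (x ^+ n) = (n * dlog g x)%N %[mod 4].
Proof.
by move=> x0; have /(congr1 (modn^~ 4)) := dlogX gP n x0; rewrite !modn_dvdm.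
Qed.

Lemma dlogN14 : dlog g (-1) = (#|F|.-1 %/ 2)%N %[mod 4].
Proof.
have /(congr1 (modn^~ 4)) := dlogN1 gP (dvdn_trans (isT : 2 %| 4)%N h4).
by rewrite !modn_dvdm.
Qed.

Lemma dlog_gen4 : dlog g g = 1 %[mod 4].
Proof.
by have /(congr1 (modn^~ 4)) := dlog_expr gP 1; rewrite !modn_dvdm.
Qed.

Lemma dlog14 : dlog g 1 = 0 %[mod 4].
Proof.
by have /(congr1 (modn^~ 4)) := dlog1 gP; rewrite !modn_dvdm.
Qed.

Section Chi.
Variables (L : fieldType) (I : L).
Hypothesis IP : 4.-primitive_root I.
Local Notation chi := (chi g I).

Lemma chi_mul_char j : mul_char (chi j).
Proof.
split; rewrite /chi ?eqxx ?oner_eq0 //.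
  by apply/eqP; rewrite prim4_eq1 // dvdn_mull // /dvdn dlog14.
move=> x y; rewrite mulf_eq0; case: eqP => [|/eqP x0]; first by rewrite mul0r.
case: eqP => [|/eqP y0] /=; first by rewrite mulr0.
rewrite -exprD -mulnDr; apply/eqP; rewrite (eq_prim_root_expr IP).
by rewrite -modnMmr dlogM4 // modnMmr.
Qed.

Lemma chi_nontrivial j : ~~ (4 %| j)%N -> nontrivial (chi j).
Proof.
move=> hj; exists g; first exact: prim_neq0 gP.
by rewrite /chi (negPf (prim_neq0 gP)) prim4_eq1 // /dvdn -modnMmr dlog_gen4 modnMmr muln1.
Qed.

Lemma chi_eqmod j j' : j = j' %[mod 4] -> chi j =1 chi j'.
Proof.
move=> h x; rewrite /chi; case: eqP => // _; apply/eqP.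
by rewrite (eq_prim_root_expr IP) -modnMml h modnMml.
Qed.

Lemma chi_mul i j x : chi i x * chi j x = chi (i + j) x.
Proof.
by rewrite /chi; case: eqP => _; rewrite ?mul0r // -exprD -mulnDl.
Qed.

Lemma chi_inv i j x : (4 %| i + j)%N -> chi j x = (chi i x)^-1.
Proof.
move=> ij; rewrite /chi; case: eqP => _; first by rewrite invr0.
have h : I ^+ (j * dlog g x) * I ^+ (i * dlog g x) = 1.
  by apply/eqP; rewrite -exprD -mulnDl prim4_eq1 // dvdn_mulr // addnC.
by rewrite -[RHS]mul1r -h mulfK // expf_neq0 // (prim_root_neq0 IP).
Qed.

Lemma chi2N1 : chi 2 (-1) = 1.
Proof.
rewrite /chi oppr_eq0 oner_eq0; apply/eqP; rewrite prim4_eq1 // /dvdn -modnMmr.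
rewrite dlogN14 modnMmr; case/dvdnP: h4 => c ->.
by rewrite (_ : (c * 4)%N = (c * 2 * 2)%N) ?mulnK //; lia.
Qed.

Lemma sum_chi j : ~~ (4 %| j)%N -> \sum_x chi j x = 0.
Proof. by move=> hj; rewrite sum_nontrivial //; [exact: chi_mul_char|exact: chi_nontrivial]. Qed.

Lemma jacobi_conj_sum j : ~~ (4 %| j)%N ->
  \sum_v chi j v / chi j (1 - v) = - chi j (-1).
Proof. by move=> hj; rewrite jacobi_inv //; [exact: chi_mul_char|exact: chi_nontrivial]. Qed.
End Chi.
End Quartic.

(** * The Jacobi sum of the quartic and the quadratic character *)

Section JacobiSum.
Variables (F : finFieldType) (g : F).
Hypotheses (gP : (#|F|.-1).-primitive_root g) (h4 : (4 %| #|F|.-1)%N).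

(** Real and imaginary part of the Jacobi sum of the quartic and the quadratic
    character.  They are integers that do not depend on the field in which the
    characters take their values, which is what lets one Jacobi sum be read both
    in characteristic 0 and in characteristic l. *)
Definition jac_re : int :=
  \sum_(v | (v != 0) && (v != 1)) re4 (dlog g v) * (-1) ^+ dlog g (1 - v).
Definition jac_im : int :=
  \sum_(v | (v != 0) && (v != 1)) im4 (dlog g v) * (-1) ^+ dlog g (1 - v).

Section Values.
Variables (L : fieldType) (I : L).
Hypothesis IP : 4.-primitive_root I.

Definition jac : L := jacobi (chi g I 1) (chi g I 2).

(** The quadratic character is I ^ (2 n) = (-1) ^ n, which is already integral. *)
Lemma jacE : jac = jac_re%:~R + jac_im%:~R * I.
Proof.
rewrite /jac /jacobi /jac_re /jac_im !rmorph_sum /= mulr_suml -big_split /=.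
rewrite [LHS]big_mkcond [RHS]big_mkcond; apply: eq_bigr => v _.
rewrite /chi subr_eq0 [1 == v]eq_sym.
case: eqP => [_|_]; first by rewrite mul0r.
case: eqP => [_|_] /=; first by rewrite mulr0.
rewrite mul1n (expr_re_im IP) exprM (sqr_prim4 IP) !rmorphM /= !rmorphXn /= !rmorphN1.
by ring.
Qed.

Lemma chiN j : chi g (- I) j =1 chi g I (3 * j).
Proof.
move=> x; rewrite /chi; case: eqP => // _.
by rewrite -mulnA (exprM I) (exprSr _ 2) (sqr_prim4 IP) mulN1r.
Qed.

End Values.

Section GaussValues.
Variables (L : fieldType) (I : L).
Hypothesis IP : 4.-primitive_root I.
Variable e : F -> L.
Hypotheses (eD : forall x y, e (x + y) = e x * e y) (e0 : e 0 = 1)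
  (sum_e : \sum_x e x = 0) (q0 : #|F|%:R != 0 :> L).

Local Notation G j := (gauss e (chi g I j)).

Lemma eq_gauss f f' : f =1 f' -> gauss e f = gauss e f'.
Proof. by move=> ff; apply: eq_bigr => x _; rewrite ff. Qed.

Lemma eq_nontrivial (f f' : F -> L) : f =1 f' -> nontrivial f -> nontrivial f'.
Proof. by move=> ff [a a0 fa]; exists a; rewrite -?ff. Qed.

Lemma gauss13 : G 1 * G 3 = chi g I 1 (-1) * #|F|%:R.
Proof.
apply: gauss_inv => //; first by [exact: chi_mul_char].
- exact: chi_mul_char.
- exact: chi_nontrivial.
- by move=> x; apply: chi_inv.
Qed.

Lemma gauss22 : G 2 ^+ 2 = #|F|%:R.
Proof.
rewrite expr2 (gauss_inv eD e0 sum_e (f := chi g I 2)) ?chi2N1 ?mul1r //.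
- exact: chi_mul_char.
- exact: chi_mul_char.
- exact: chi_nontrivial.
- by move=> x; apply: chi_inv.
Qed.

Lemma gauss_neq0 : G 1 != 0.
Proof.
have : G 1 * G 3 != 0.
  rewrite gauss13 mulf_neq0 // mul_char_neq0 ?oppr_eq0 ?oner_eq0 //.
  exact: chi_mul_char.
by rewrite mulf_eq0 negb_or => /andP [].
Qed.

Lemma gauss12 : G 1 * G 2 = jac I * G 3.
Proof.
have E : (fun x => chi g I 1 x * chi g I 2 x) =1 chi g I 3.
  by move=> x; rewrite chi_mul.
rewrite gauss_jacobi //; first by rewrite (eq_gauss E).
- exact: chi_mul_char.
- exact: chi_mul_char.
- by apply: (eq_nontrivial (fun x => esym (E x))); apply: chi_nontrivial.
Qed.

(** Multiplying G 1 * G 2 = J * G 3 by G 1 and squaring removes G 3, since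
    G 1 * G 3 = chi (-1) q and G 2 ^ 2 = q. *)
Lemma gauss_pow4 : G 1 ^+ 4 = jac I ^+ 2 * #|F|%:R.
Proof.
apply: (mulIf q0).
have -> : G 1 ^+ 4 * #|F|%:R = (G 1 * (G 1 * G 2)) ^+ 2 by rewrite -gauss22; ring.
rewrite gauss12 mulrCA gauss13 !exprMn.
have -> : chi g I 1 (-1) ^+ 2 = 1 by rewrite expr2 chi_mul chi2N1.
ring.
Qed.
End GaussValues.

(** The relation G 1 * G 2 = J * G 3 and its conjugate are multiplied and G 1 * G 3
    is cancelled. *)
Lemma jac_norm (L : fieldType) (I : L) (e : F -> L) : 4.-primitive_root I ->
  (forall x y, e (x + y) = e x * e y) -> e 0 = 1 -> \sum_x e x = 0 ->
  #|F|%:R != 0 :> L -> jac I * jac (- I) = #|F|%:R.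
Proof.
move=> IP eD e0 se q0; have NP := prim4N IP.
pose G j := gauss e (chi g I j).
have h1 : G 1 * G 2 = jac I * G 3 by apply: gauss12.
have h2 : G 3 * G 2 = jac (- I) * G 1.
  have E j j' : (3 * j = j' %[mod 4])%N -> gauss e (chi g (- I) j) = G j'.
    by move=> jj; apply: eq_gauss => x; rewrite (chiN IP); apply: chi_eqmod jj x.
  by have := gauss12 NP eD e0; rewrite (E _ 3) // (E _ 2) // (E _ 1).
have h3 : G 1 * G 3 != 0.
  rewrite [G 1 * _]gauss13 // mulf_neq0 // mul_char_neq0 ?oppr_eq0 ?oner_eq0 //.
  exact: chi_mul_char.
apply: (mulIf h3); rewrite -(gauss22 IP eD e0 se).
transitivity ((jac I * G 3) * (jac (- I) * G 1)); first by ring.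
rewrite -h1 -h2 -[gauss _ _]/(G 2); move: (G 1) (G 2) (G 3) => a b c; ring.
Qed.
End JacobiSum.

(** A primitive p-th root of unity gives an additive character of F_p with all
    the properties that Gauss sums need. *)
Lemma Fp_additive_char (p : nat) (L : fieldType) (z : L) : prime p ->
  p.-primitive_root z ->
  let e := fun x : 'F_p => z ^+ (x : nat) in
  [/\ forall x y, e (x + y) = e x * e y, e 0 = 1, \sum_x e x = 0
    & forall n, e n%:R = z ^+ n].
Proof.
move=> pp zP e.
have en n : e n%:R = z ^+ n.
  by rewrite /e val_Fp_nat // (prim_expr_mod zP).
have eD x y : e (x + y) = e x * e y.
  by rewrite -[x]natr_Zp -[y]natr_Zp -natrD !en exprD.
split=> //.
have e1 : e 1 != 1.
  rewrite (en 1%N) expr1; apply/eqP => z1.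
  have := prim_order_dvd zP 1; rewrite z1 expr1 eqxx dvdn1.
  by move: pp; case: eqP => // ->.
have E : \sum_x e x = e 1 * \sum_x e x.
  rewrite mulr_sumr [LHS](reindex (fun x => x + 1)) /=; last first.
    by exists (fun x => x - 1) => x _; [exact: addrK | exact: subrK].
  by apply: eq_bigr => x _; rewrite eD mulrC.
apply/eqP; have /eqP : (e 1 - 1) * \sum_x e x = 0 by rewrite mulrBl -E mul1r subrr.
by rewrite mulf_eq0 subr_eq0 (negPf e1).
Qed.

(** * The Jacobi sum is primary *)

Lemma Ci_prim4 : 4.-primitive_root ('i : algC).
Proof. by apply: sqr_is_prim4; rewrite ?sqrCi ?pnatr_eq0. Qed.

Lemma int_complex_inj (a b c d : int) :
  a%:~R + b%:~R * 'i = c%:~R + d%:~R * 'i :> algC -> a = c /\ b = d.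
Proof.
have r (z : int) : (z%:~R : algC) \is Num.real by rewrite realz.
move=> h; have := congr1 (@Re _) h; have := congr1 (@Im _) h.
rewrite ![_ * 'i]mulrC !Re_rect ?Im_rect //.
by move/eqP; rewrite eqr_int => /eqP -> /eqP; rewrite eqr_int => /eqP ->.
Qed.

Lemma sum_re_im (T : finType) (P : pred T) (k : T -> nat) :
  \sum_(x | P x) 'i ^+ k x = (\sum_(x | P x) re4 (k x))%:~R
     + (\sum_(x | P x) im4 (k x))%:~R * 'i :> algC.
Proof.
rewrite !rmorph_sum /= mulr_suml -big_split; apply: eq_bigr => x _.
by rewrite (expr_re_im Ci_prim4).
Qed.

Section Primary.
Variables (F : finFieldType) (g : F).
Hypotheses (gP : (#|F|.-1).-primitive_root g) (h4 : (4 %| #|F|.-1)%N).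

Lemma sum_chi_units j : ~~ (4 %| j)%N ->
  \sum_(x | x != 0) re4 (j * dlog g x) = 0 /\
  \sum_(x | x != 0) im4 (j * dlog g x) = 0.
Proof.
move=> hj; apply: int_complex_inj; rewrite -sum_re_im mul0r addr0.
have := sum_chi gP h4 Ci_prim4 hj; rewrite (bigD1 0) //= {1}/chi eqxx add0r => h; rewrite -[RHS]h.
by apply: eq_bigr => x; rewrite /chi => /negPf ->.
Qed.

Lemma re4_even n : re4 (2 * n) = (-1) ^+ n.
Proof.
by rewrite -signr_odd /re4 -[4%N]/(2 * 2)%N -muln_modr modn2; case: (odd n).
Qed.

(** With chi the quartic and phi the quadratic character, each product
    (chi v - 1) * (phi (1 - v) - 1) is divisible by 2 + 2 i.  Summing over v other
    than 0 and 1 gives J = - q modulo 2 + 2 i, as the sums of chi and of phi over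
    these v are both -1.  An integer a + b i is divisible by 2 + 2 i exactly when
    b is even and a + b is divisible by 4. *)
Lemma jac_primary :
  (2 %| jac_im g)%Z /\ (4 %| jac_re g + jac_im g + #|F|%:Z)%Z.
Proof.
have l1 : re4 (dlog g 1) = 1 by rewrite /re4 dlog14.
have l1' : im4 (dlog g 1) = 0 by rewrite /im4 dlog14.
have [s1 s2] := sum_chi_units (j := 1) isT.
have [s3 _] := sum_chi_units (j := 2) isT.
have E (f : F -> int) :
    \sum_(v | (v != 0) && (v != 1)) f v = \sum_(v | v != 0) f v - f 1.
  by rewrite [in RHS](bigD1 1) ?oner_neq0 //= addrAC subrr add0r.
have s2' : \sum_(v | (v != 0) && (v != 1)) im4 (dlog g v) = 0.
  by rewrite E l1' subr0 -[RHS]s2; apply: eq_bigr => v _; rewrite mul1n.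
have s1' : \sum_(v | (v != 0) && (v != 1)) re4 (dlog g v) = -1.
  rewrite E l1 [X in X - _](_ : _ = 0) // -[RHS]s1.
  by apply: eq_bigr => v _; rewrite mul1n.
have s3' : \sum_(v : F | (v != 0) && (v != 1)) (-1 : int) ^+ dlog g (1 - v) = -1.
  rewrite (reindex_inj (inv_inj (subKr 1))) /=.
  rewrite (eq_bigl (fun v => (v != 0) && (v != 1))); last first.
    move=> v; have -> : (1 - v == 1) = (v == 0).
      by rewrite -subr_eq0 addrAC subrr add0r oppr_eq0.
    by rewrite subr_eq0 [1 == v]eq_sym andbC.
  rewrite E [X in X - _](_ : _ = 0); last first.
    by rewrite -[RHS]s3; apply: eq_bigr => v _; rewrite subKr re4_even.
  have h0 : dlog g 1 = 0 %[mod 2].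
    have /(congr1 (modn^~ 2)) := dlog14 gP h4; rewrite !modn_dvdm //.
  by move: h0; rewrite modn2 mod0n subKr -signr_odd; case: odd.
have c0 : \sum_(v : F | (v != 0) && (v != 1)) 1 = #|F|%:Z - 2.
  rewrite E; have <- : \sum_(x : F) 1 = #|F|%:Z by rewrite -sum1_card -[RHS]natz natr_sum.
  by rewrite [in RHS](bigD1 0) //=; ring.
have two n : (2 %| (-1 : int) ^+ n - 1)%Z by rewrite -signr_odd; case: odd.
split.
  have -> : jac_im g = \sum_(v | (v != 0) && (v != 1))
      im4 (dlog g v) * ((-1) ^+ dlog g (1 - v) - 1).
    by under eq_bigr do rewrite mulrBr mulr1; rewrite sumrB s2' subr0.
  by apply: rpred_sum => v _; rewrite dvdz_mull.
have : (4 %| \sum_(v | (v != 0%R) && (v != 1%R))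
   (re4 (dlog g v) + im4 (dlog g v) - 1) * ((-1) ^+ dlog g (1 - v)%R - 1))%Z.
  apply: rpred_sum => v _; apply: (@dvdz_mul 2 2); last exact: two.
  by rewrite /re4 /im4; case: (mod4_cases (dlog g v)) => ->.
rewrite (eq_bigr (fun v => re4 (dlog g v) * (-1) ^+ dlog g (1 - v)
   + im4 (dlog g v) * (-1) ^+ dlog g (1 - v) - re4 (dlog g v) - im4 (dlog g v)
   - (-1) ^+ dlog g (1 - v) + 1)); last by move=> v _; ring.
rewrite big_split /= c0 !sumrB big_split /= s1' s2' s3' -/(jac_re g) -/(jac_im g).
by apply: etrans; congr (4 %| _)%Z; ring.
Qed.
End Primary.

Lemma jac_norm_Fp (p : nat) (g : 'F_p) : prime p -> (4 %| p.-1)%N ->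
  (#|'F_p|.-1).-primitive_root g -> jac_re g ^+ 2 + jac_im g ^+ 2 = p%:Z.
Proof.
move=> pp p4 gP; have cp := card_Fp pp.
have h4 : (4 %| #|'F_p|.-1)%N by rewrite cp.
have [z zP] := C_prim_root_exists (prime_gt0 pp).
have [eD e0 se _] := Fp_additive_char pp zP.
have := jac_norm gP h4 Ci_prim4 eD e0 se _.
rewrite cp pnatr_eq0 -lt0n prime_gt0 // => /(_ isT).
rewrite (jacE g Ci_prim4) (jacE g (prim4N Ci_prim4)) => h.
have : (jac_re g ^+ 2 + jac_im g ^+ 2)%:~R + 0%:~R * 'i = p%:Z%:~R + 0%:~R * 'i :> algC.
  rewrite !mul0r !addr0 -[RHS]h rmorphD !rmorphXn /=.
  by have i2 := sqrCi algC; transitivity ((jac_re g)%:~R ^+ 2 - (jac_im g)%:~R ^+ 2 * 'i ^+ 2 : algC); [rewrite i2; ring | ring].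
by case/int_complex_inj.
Qed.

(** * Counting points on the curve *)

(** The curve is birational to s ^ 2 = w ^ 4 - d, through the parameter
    w = y / (2 x) of the lines through the 2-torsion point (0, 0), which is the
    one point that this change of variables misses. *)
Lemma card_curve (F : finFieldType) (d : F) : (2 : F) != 0 -> d != 0 ->
  #|[set P : F * F | P.2 ^+ 2 == P.1 ^+ 3 + (4 * d) * P.1]|
  = #|[set P : F * F | P.2 ^+ 2 == P.1 ^+ 4 - d]|.+1.
Proof.
move=> two d0; set A := [set _ | _]; set B := [set _ | _].
have memA : (0, 0) \in A by rewrite inE /= expr0n /= mulr0 addr0 expr0n.
rewrite (cardsD1 (0, 0)) memA add1n; congr _.+1.
pose f (P : F * F) := (2 * (P.2 + P.1 ^+ 2), 4 * P.1 * (P.2 + P.1 ^+ 2)).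
pose h (P : F * F) := (P.2 / (2 * P.1), P.1 / 2 - (P.2 / (2 * P.1)) ^+ 2).
have fK : {in B, cancel f h}.
  move=> [w s]; rewrite inE /= => /eqP E; rewrite /f /h /=.
  have z0 : s + w ^+ 2 != 0.
    apply: contra_neq d0 => z0; rewrite -[RHS](mulr0 (w ^+ 2 - s)) -z0.
    rewrite (_ : d = w ^+ 4 - s ^+ 2); first by ring.
    by rewrite E; ring.
  congr pair; field; by rewrite z0 two.
rewrite -(card_in_imset (can_in_inj fK)); apply: eq_card => P.
apply/idP/imsetP => [|[[w s] hB ->]]; last first.
  have := hB; rewrite !inE /= => /eqP E; apply/andP; split.
    apply: contra_neq d0 => -[e1 _].
    have z0 : s + w ^+ 2 = 0 by apply/eqP; move/eqP: e1; rewrite mulf_eq0 (negPf two).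
    rewrite -[RHS](mulr0 (w ^+ 2 - s)) -z0.
    by rewrite (_ : d = w ^+ 4 - s ^+ 2); [ring | rewrite E; ring].
  apply/eqP; rewrite (_ : d = w ^+ 4 - s ^+ 2); [ring | by rewrite E; ring].
case: P => x y; rewrite !inE /= => /andP [n0 /eqP E].
have x0 : x != 0.
  apply: contraNneq n0 => x0; move: E; rewrite x0 mulr0 expr0n addr0 => /eqP.
  by rewrite expf_eq0 /= => /eqP ->.
exists (h (x, y)); last by rewrite /f /h /=; congr pair; field; rewrite x0 two.
rewrite inE /h /= -subr_eq0; apply/eqP.
rewrite (_ : d = (y ^+ 2 - x ^+ 3) / (4 * x)); last first.
  by rewrite E; field; rewrite x0 (_ : (4 : F) = 2 * 2) ?mulf_neq0 //; ring.
by field; rewrite x0 two (_ : (4 : F) = 2 * 2) ?mulf_neq0 //; ring.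
Qed.

Section PointCount.
Variables (F : finFieldType) (g : F).
Hypotheses (gP : (#|F|.-1).-primitive_root g) (h4 : (4 %| #|F|.-1)%N).
Let I : algC := 'i.
Let IP : 4.-primitive_root I := Ci_prim4.
Local Notation chi := (chi g I).

(** The left-hand side is the number of fourth roots of u, by [sum_power]. *)
Lemma fourth_roots_chi (u : F) :
  (if u == 0 then 1%N else if (4 %| dlog g u)%N then 4%N else 0%N)%:R
  = 1 + chi 1 u + chi 2 u + chi 3 u :> algC.
Proof.
rewrite /chi; case: eqP => _; first by rewrite !addr0.
have red j : I ^+ (j * dlog g u) = I ^+ ((j * (dlog g u %% 4)) %% 4).
  by rewrite modnMmr (prim_expr_mod IP).
rewrite !red /dvdn; have i2 : 'i ^+ 2 = -1 :> algC := sqr_prim4 IP.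
by case: (mod4_cases (dlog g u)) => -> /=; rewrite /I; ring: i2.
Qed.

Lemma square_roots_chi (u : F) :
  (if u == 0 then 1%N else if (2 %| dlog g u)%N then 2%N else 0%N)%:R
  = 1 + chi 2 u :> algC.
Proof.
rewrite /chi; case: eqP => _; first by rewrite addr0.
rewrite exprM (sqr_prim4 IP) -signr_odd dvdn2.
by case: odd; rewrite ?expr1 ?expr0 ?subrr.
Qed.

Lemma sum_squares (v : F) : \sum_s (s ^+ 2 == v)%:R = 1 + chi 2 v.
Proof.
have d2 : (2 %| #|F|.-1)%N by apply: dvdn_trans h4.
rewrite (sum_power gP (fun u => (u == v)%:R) _ d2) // (bigD1 v) //= eqxx.
rewrite big1 ?addr0 ?square_roots_chi // => u /negPf ->; exact: mul0rn.
Qed.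

Lemma jacobi_shift j (d : F) : d != 0 ->
  \sum_u chi j u * chi 2 (u - d) = chi (j + 2) d * jacobi (chi j) (chi 2).
Proof.
move=> d0; rewrite (reindex (fun v => d * v)) /=; last first.
  by exists (fun x => d^-1 * x) => x _; rewrite mulrA ?mulVf ?divff ?mul1r.
rewrite mulr_sumr; apply: eq_bigr => v _.
have M i x y : chi i (x * y) = chi i x * chi i y.
  by have [_ _ ->] := chi_mul_char gP h4 IP i.
have -> : d * v - d = d * (-1 * (1 - v)) by ring.
by rewrite !M (chi2N1 gP h4 IP) -(chi_mul g I j 2); ring.
Qed.

(** Expanding the numbers of fourth and of square roots, the product of the two
    quadratic characters contributes -1 and the two quartic characters contribute
    conjugate multiples of Jacobi sums; the other mixed terms vanish. *)
Lemma curve_sum (d : F) : d != 0 ->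
  #|[set P : F * F | P.2 ^+ 2 == P.1 ^+ 4 - d]|%:R + 1 =
  #|F|%:R + (chi 3 d * jac g I + chi 1 d * jac g (- I)).
Proof.
move=> d0.
have -> : #|[set P : F * F | P.2 ^+ 2 == P.1 ^+ 4 - d]|%:R =
    \sum_w (1 + chi 2 (w ^+ 4 - d)).
  under eq_bigr do rewrite -sum_squares.
  rewrite pair_big -sum1_card natr_sum big_mkcond; apply: eq_bigr => -[w s] _.
  by rewrite inE /=; case: eqP.
rewrite (sum_power gP (fun u => 1 + chi 2 (u - d)) _ h4) //.
under eq_bigr => u _ do rewrite -mulr_natr fourth_roots_chi.
pose T j := \sum_u chi j u * chi 2 (u - d).
have -> : \sum_u (1 + chi 2 (u - d)) * (1 + chi 1 u + chi 2 u + chi 3 u) =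
   \sum_(u : F) 1 + \sum_u chi 1 u + \sum_u chi 2 u + \sum_u chi 3 u
   + \sum_u chi 2 (u - d) + T 1%N + T 2 + T 3.
  by rewrite -!big_split; apply: eq_bigr => u _ /=; ring.
rewrite !(sum_chi gP h4 IP) // /T !jacobi_shift //.
have -> : \sum_u chi 2 (u - d) = 0.
  rewrite (reindex (fun u => u + d)) /=; last first.
    by exists (fun u => u - d) => u _; [exact: addrK | exact: subrK].
  by under eq_bigr do rewrite addrK; rewrite (sum_chi gP h4 IP).
have -> : jacobi (chi 2) (chi 2) = -1.
  rewrite -[in RHS](chi2N1 gP h4 IP) -(jacobi_conj_sum gP h4 IP (j := 2)) //.
  by apply: eq_bigr => v _; congr (_ * _); apply: chi_inv.
have -> : chi 4 d = 1 by rewrite /chi (negPf d0) exprM (prim_expr_order IP) expr1n.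
have E5 : chi 5 d = chi 1 d by apply: chi_eqmod.
have -> : jacobi (chi 3) (chi 2) = jac g (- I).
  apply: eq_bigr => v _; rewrite !(chiN g IP); congr (_ * _).
  exact: (chi_eqmod g IP (j := 2) (j' := 6)).
rewrite sumr_const E5 -/(jac g I).
by rewrite (_ : #|{: F}| = #|F|) //; ring.
Qed.
End PointCount.

(** * The trace of Frobenius at a sum of two squares *)

(** The prime p divides (a d - b c) * (a d + b c).  If p divides the factor
    a d - s b c with s = 1 or -1, then the identity
    (a c + s b d) ^ 2 + (a d - s b c) ^ 2 = p ^ 2 and the parity of a c + s b d
    force that factor to vanish. *)
Lemma two_squares_unique (p : nat) (a b c d : int) : prime p ->
  a ^+ 2 + b ^+ 2 = p%:Z -> c ^+ 2 + d ^+ 2 = p%:Z ->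
  ~~ (2 %| a)%Z -> (2 %| b)%Z -> ~~ (2 %| c)%Z -> (2 %| d)%Z ->
  a ^+ 2 = c ^+ 2 /\ b ^+ 2 = d ^+ 2.
Proof.
move=> pp h1 h2 oa /dvdzP [b' bE] oc /dvdzP [d' dE].
suff ac : a ^+ 2 = c ^+ 2 by split=> //; move: h1; rewrite -h2 ac; lia.
have aux (s : int) : s ^+ 2 = 1 -> (p %| a * d - s * (b * c))%Z -> a ^+ 2 = c ^+ 2.
  move=> s2 pd; have E : (a * c + s * b * d) ^+ 2 + (a * d - s * (b * c)) ^+ 2 = p%:Z ^+ 2.
    rewrite [RHS]expr2 -{1}h1 -h2.
    transitivity (a ^+ 2 * c ^+ 2 + s ^+ 2 * (b ^+ 2 * d ^+ 2) + a ^+ 2 * d ^+ 2 + s ^+ 2 * (b ^+ 2 * c ^+ 2)).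
      by ring.
    by rewrite s2; ring.
  have n0 : a * c + s * b * d != 0.
    apply/eqP => z; have : ~~ (2 %| a * c)%Z.
      move: oa oc; rewrite !dvdzE /= abszM Euclid_dvdM //; by case: (2 %| _)%N => //=.
    have -> : a * c = - (s * b' * d) * 2.
      by apply/eqP; rewrite -subr_eq0 -z bE; apply/eqP; ring.
    by rewrite dvdz_mull.
  have z : a * d - s * (b * c) = 0.
    case/dvdzP: pd => q qE; rewrite qE.
    have [->|q0] := eqVneq q 0; first by rewrite mul0r.
    have : 0 < (a * c + s * b * d) ^+ 2 by rewrite exprn_even_gt0.
    have p0 : 0 < p%:Z ^+ 2 by rewrite exprn_gt0 // ltz_nat prime_gt0.
    have q1 : 1 <= q ^+ 2 by have : 0 < q ^+ 2 by rewrite exprn_even_gt0.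
    have q2 : 0 <= (q ^+ 2 - 1) * p%:Z ^+ 2 by rewrite mulr_ge0 ?subr_ge0 // ltW.
    move: E; rewrite qE exprMn; move: q2; rewrite mulrBl mul1r.
    have key (u v w : int) : 0 <= u - v -> w + u = v -> 0 < w -> False by lia.
    by move=> k1 k2 /(key _ _ _ k1 k2).
  have : p%:Z * (a ^+ 2 - c ^+ 2) = 0.
    have e : a ^+ 2 * d ^+ 2 = b ^+ 2 * c ^+ 2.
      have -> : a ^+ 2 * d ^+ 2 = (a * d) ^+ 2 by ring.
      rewrite (_ : a * d = s * (b * c)); last by apply/eqP; rewrite -subr_eq0 z.
      by rewrite !exprMn s2 mul1r.
    transitivity (p%:Z * a ^+ 2 - p%:Z * c ^+ 2); first by ring.
    rewrite -{1}h2 -h1; transitivity (a ^+ 2 * d ^+ 2 - b ^+ 2 * c ^+ 2); first by ring.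
    by rewrite e subrr.
  move/eqP; rewrite mulf_eq0 subr_eq0 => /orP [|/eqP //].
  by move: (prime_gt0 pp); case: p {pp h1 h2 pd E}.
have : (p %| (a * d - 1 * (b * c)) * (a * d - (-1) * (b * c)))%Z.
  rewrite (_ : _ * _ = (a ^+ 2 - c ^+ 2) * p%:Z) ?dvdz_mull //.
  transitivity (a ^+ 2 * (c ^+ 2 + d ^+ 2) - c ^+ 2 * (a ^+ 2 + b ^+ 2)); first by ring.
  by rewrite h1 h2; ring.
rewrite dvdzE abszM /= Euclid_dvdM // => /orP [] h.
  by apply: (aux 1).
by apply: (aux (-1)).
Qed.

Section Trace.
Variables (p : nat) (g : 'F_p).
Hypotheses (pp : prime p) (p4 : (4 %| p.-1)%N)
  (gP : (#|'F_p|.-1).-primitive_root g).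

(** By [card_curve] and [curve_sum] the trace is minus twice the real part of
    conj (chi d) J; the four cases are the four values of chi d. *)
Lemma trace_eq (d : int) : (d%:~R : 'F_p) != 0 ->
  E_trace (4 * d) p =
  match (dlog g (d%:~R : 'F_p) %% 4)%N with
  | 0 => - (2 * jac_re g) | 1 => - (2 * jac_im g)
  | 2 => 2 * jac_re g | _ => 2 * jac_im g end.
Proof.
move=> d0; have cp := card_Fp pp; have h4 : (4 %| #|'F_p|.-1)%N by rewrite cp.
have IP := Ci_prim4; have i2 : 'i ^+ 2 = -1 :> algC := sqr_prim4 IP.
have two : (2 : 'F_p) != 0.
  rewrite -(dvdn_pcharf (pchar_Fp pp)) dvdn_prime2 //; apply/eqP => p2.
  by move: p4; rewrite p2.
have := curve_sum gP h4 d0; rewrite cp => E.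
have E' : E_trace (4 * d) p = p%:Z - #|[set P : 'F_p * 'F_p | P.2 ^+ 2 == P.1 ^+ 4 - d%:~R]|%:Z - 1.
  rewrite /E_trace /E_points.
  under eq_finset do rewrite rmorphM /=.
  have key (n : nat) : 1 + p%:Z - n.+2%:Z = p%:Z - n%:Z - 1 by lia.
  by rewrite card_curve //; apply: key.
apply: (@intr_inj algC); rewrite {}E'.
rewrite -addrA -opprD rmorphB rmorphD /= E opprD addrA subrr add0r.
rewrite (jacE g IP) (jacE g (prim4N IP)) /chi (negPf d0).
have red j : 'i ^+ (j * dlog g (d%:~R : 'F_p)) = 'i ^+ ((j * (dlog g (d%:~R : 'F_p) %% 4)) %% 4) :> algC.
  by rewrite modnMmr (prim_expr_mod IP).
rewrite !red; case: (mod4_cases (dlog g (d%:~R : 'F_p))) => -> /=;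
  rewrite ?rmorphN ?rmorphM /=; ring: i2.
Qed.

(** Both p = alpha ^ 2 + x ^ 2 and p = jac_re ^ 2 + jac_im ^ 2, and a Jacobi sum
    is primary, so -jac_re is alpha or -alpha according to x modulo 4. *)
Lemma trace_criterion (alpha x d : int) : (alpha = 1 %[mod 4])%Z ->
  p%:Z = alpha ^+ 2 + x ^+ 2 -> (2 %| x)%Z -> (d%:~R : 'F_p) != 0 ->
  (E_trace (4 * d) p == 2 * alpha) =
    (dlog g (d%:~R : 'F_p) == (if (4 %| x)%Z then 0 else 2) %[mod 4])%N /\
  (E_trace (4 * d) p == 2 * - alpha) =
    (dlog g (d%:~R : 'F_p) == (if (4 %| x)%Z then 2 else 0) %[mod 4])%N.
Proof.
move=> ha px x2 d0; have cp := card_Fp pp; have h4 : (4 %| #|'F_p|.-1)%N by rewrite cp.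
have [B2 AB4] := jac_primary gP h4; have N := jac_norm_Fp pp p4 gP.
rewrite trace_eq //; move: AB4 B2 N; rewrite cp.
move: (jac_re g) (jac_im g) => A B AB4 B2 N.
have a2 : ~~ (2 %| alpha)%Z by lia.
have pm : (p%:Z = 1 %[mod 4])%Z by have := prime_gt0 pp; lia.
have A2 : ~~ (2 %| A)%Z by lia.
have [e1 e2] := two_squares_unique pp N (esym px) A2 B2 a2 x2.
have hA : A = alpha \/ A = - alpha by move/eqP: e1; rewrite eqf_sqr => /orP [] /eqP; tauto.
have hB : B = x \/ B = - x by move/eqP: e2; rewrite eqf_sqr => /orP [] /eqP; tauto.
clear -hA hB AB4 B2 ha x2 pm.
case: (mod4_cases (dlog g (d%:~R : 'F_p))) => ->; case: ifP => h;
  case: hA => ?; case: hB => ?; split; apply/eqP/eqP; lia.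
Qed.
End Trace.

(** * Quartic reciprocity for rational primes *)

(** In an algebraic closure of K, a root of 1 + X + ... + X ^ (p - 1) is a primitive
    p-th root of unity, because p is not the characteristic. *)
Lemma exists_root_of_unity (K : finFieldType) (l p : nat) : l \in [pchar K] ->
  prime p -> p != l ->
  exists (L : fieldType) (f : {rmorphism K -> L}) (z : L), p.-primitive_root z.
Proof.
move=> lK pp pl; have [L [f _]] := countable_algebraic_closure K.
exists L, f; pose P : {poly L} := \sum_(i < p) 'X^i.
have sP : size P != 1%N.
  suff -> : size P = p by apply: contraTneq pp => ->.
  have -> : P = \poly_(i < p) 1 by rewrite poly_def; apply: eq_bigr => i _; rewrite scale1r.
  by rewrite size_poly_eq ?oner_neq0.
have /closed_rootP [z /rootP zP] := sP.
have z1 : z ^+ p = 1.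
  apply/eqP; rewrite -subr_eq0 subrX1 mulf_eq0; apply/orP; right.
  rewrite -[X in _ == X]zP /P horner_sum; apply/eqP.
  by apply: eq_bigr => i _; rewrite hornerXn.
exists z; have [m mP mp] := prim_order_exists (prime_gt0 pp) z1.
have [m1|m1] := eqVneq m 1%N; last by rewrite -(prime_nt_dvdP pp m1 mp).
have ze : z = 1 by have := prim_expr_order mP; rewrite m1 expr1.
have : (p%:R : L) = 0.
  rewrite -[RHS]zP /P horner_sum -[p in LHS]card_ord -sum1_card natr_sum.
  by apply: eq_bigr => i _; rewrite hornerXn ze expr1n.
move/eqP; rewrite -(dvdn_pcharf (rmorph_pchar f lK)) dvdn_prime2 ?(negPf _) //.
  by rewrite eq_sym (negPf pl).
exact: pcharf_prime lK.
Qed.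

(** The exponents that occur in [reciprocity3], written with n = (l + 1) / 4. *)
Lemma exponent_3mod4 l : (l %% 4 = 3)%N ->
  (l + 1 = 4 * ((l + 1) %/ 4))%N /\
  ((l - 1) * ((l + 1) %/ 4) + (l + 1) = (2 + (l + 1)) * ((l + 1) %/ 4))%N.
Proof.
move=> l3; have [m ->] : exists m, l = (4 * m + 3)%N by exists (l %/ 4)%N; lia.
have -> : ((4 * m + 3 + 1) %/ 4 = m.+1)%N by lia.
by rewrite (_ : 4 * m + 3 - 1 = 4 * m + 2)%N; lia.
Qed.

Section Reciprocity.
Variables (p : nat) (g : 'F_p).
Hypotheses (pp : prime p) (p4 : (4 %| p.-1)%N)
  (gP : (#|'F_p|.-1).-primitive_root g).
Variables (K : finFieldType) (h : K) (l : nat).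
Hypotheses (hP : (#|K|.-1).-primitive_root h) (K4 : (4 %| #|K|.-1)%N)
  (lK : l \in [pchar K]) (lp : p != l).

Let IK := h ^+ (#|K|.-1 %/ 4).

Lemma quartic_root_prim4 : 4.-primitive_root IK.
Proof.
have N0 := prim_order_gt0 hP.
have -> : 4%N = (#|K|.-1 %/ gcdn (#|K|.-1 %/ 4) #|K|.-1)%N.
  rewrite (gcdn_idPl _); last by apply: dvdn_div.
  by case/dvdnP: K4 N0 => c ->; rewrite mulnK // muln_gt0 => /andP [c0 _]; rewrite mulKn.
exact: exp_prim_root.
Qed.

Lemma dlog_quartic (x : K) : x != 0 -> x ^+ (#|K|.-1 %/ 4) = IK ^+ dlog h x.
Proof. by move=> x0; rewrite -{1}(dlogK hP x0) /IK -!exprM mulnC. Qed.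

(** Frobenius raises a quartic Gauss sum, computed in characteristic l, to its
    l-th power; this compares the quartic character of l modulo p with powers of
    the Jacobi sum modulo l. *)
Lemma gauss_frobenius (L : fieldType) (f : {rmorphism K -> L}) (e : 'F_p -> L) (z : L) :
  p.-primitive_root z -> (forall n, e n%:R = z ^+ n) ->
  chi g (f IK) l (l%:R) * gauss e (chi g (f IK) 1) ^+ l = gauss e (chi g (f IK) l).
Proof.
move=> zP eE; have lL := rmorph_pchar f lK; have lp' := pcharf_prime lK.
have h4 : (4 %| #|'F_p|.-1)%N by rewrite card_Fp.
have IP : 4.-primitive_root (f IK) by rewrite fmorph_primitive_root quartic_root_prim4.
have l0 : (l%:R : 'F_p) != 0.
  by rewrite -(dvdn_pcharf (pchar_Fp pp)) dvdn_prime2.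
rewrite -(pFrobenius_autE lL) rmorph_sum mulr_sumr /=.
rewrite [RHS](reindex (fun x => l%:R * x)) /=; last first.
  by exists (fun x => l%:R^-1 * x) => x _; rewrite mulrA ?mulVf ?divff ?mul1r.
apply: eq_bigr => x _; have [_ _ ->] := chi_mul_char gP h4 IP l.
rewrite -mulrA pFrobenius_autE exprMn; congr (_ * (_ * _)).
  rewrite /chi; case: eqP => _; first by rewrite expr0n gtn_eqF ?prime_gt0.
  by rewrite mul1n -exprM mulnC.
by rewrite -[x]natr_Zp -natrM !eE -exprM mulnC.
Qed.

Let J : K := (jac_re g)%:~R + (jac_im g)%:~R * IK.
Let J' : K := (jac_re g)%:~R - (jac_im g)%:~R * IK.

(** Read in an extension of K that contains the p-th roots of unity; the Jacobi
    sum itself already lives in K. *)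
Lemma gauss_identities : exists (L : fieldType) (f : {rmorphism K -> L}) (e : 'F_p -> L),
  let I := f IK in let G j := gauss e (chi g I j) in
  [/\ 4.-primitive_root I, chi g I l l%:R * G 1 ^+ l = G l,
      G 1 * G 3 = chi g I 1 (-1) * p%:R,
      G 1 ^+ 4 = f J ^+ 2 * p%:R /\ f J * f J' = p%:R & G 1 != 0].
Proof.
have cp := card_Fp pp; have h4 : (4 %| #|'F_p|.-1)%N by rewrite cp.
have [L [f [z zP]]] := exists_root_of_unity lK pp lp.
have [eD e0 se eE] := Fp_additive_char pp zP.
exists L, f, (fun x : 'F_p => z ^+ (x : nat)) => I G.
have IP : 4.-primitive_root I by rewrite fmorph_primitive_root quartic_root_prim4.
have p0 : #|'F_p|%:R != 0 :> L.
  rewrite cp -(dvdn_pcharf (rmorph_pchar f lK)) dvdn_prime2 //; last exact: pcharf_prime lK.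
  by rewrite eq_sym.
have fJ : f J = jac g I by rewrite (jacE g IP) /J rmorphD rmorphM !rmorph_int.
have fJ' : f J' = jac g (- I).
  by rewrite (jacE g (prim4N IP)) /J' rmorphB rmorphM !rmorph_int mulrN.
split=> //.
- by apply: (gauss_frobenius f zP eE).
- by rewrite /G (gauss13 gP h4 IP eD e0 se) cp.
- split; first by rewrite fJ /G (gauss_pow4 gP h4 IP eD e0 se p0) cp.
  by rewrite fJ fJ' (jac_norm gP h4 IP eD e0 se p0) cp.
- exact: (gauss_neq0 gP h4 IP eD e0 se p0).
Qed.

Lemma jac_neq0 : J != 0 /\ J' != 0.
Proof.
have [L [f [e [_ _ _ [_ h2] _]]]] := gauss_identities.
have : f J * f J' != 0.
  rewrite h2 -(dvdn_pcharf (rmorph_pchar f lK)) dvdn_prime2 //; last exact: pcharf_prime lK.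
  by rewrite eq_sym.
by rewrite mulf_eq0 negb_or !fmorph_eq0 => /andP.
Qed.

(** Here G 1 ^ (l - 1) is the inverse of chi (l), while G 1 ^ 4 = J ^ 3 * J'.  The
    argument of the logarithm is J * J' ^ 3 because (J ^ 3 * J') * (J * J' ^ 3) is
    a fourth power. *)
Lemma reciprocity1 : #|K| = l -> (l %% 4 = 1)%N ->
  dlog g (l%:R : 'F_p) = dlog h (J * J' ^+ 3) %[mod 4].
Proof.
move=> Kl l1; have cp := card_Fp pp; have h4 : (4 %| #|'F_p|.-1)%N by rewrite cp.
have [L [f [e [IP frob _ [G4 JJ] G0]]]] := gauss_identities; have [J0 J'0] := jac_neq0.
have l0 : (l%:R : 'F_p) != 0.
  by rewrite -(dvdn_pcharf (pchar_Fp pp)) dvdn_prime2 //; exact: pcharf_prime lK.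
set n := (#|K|.-1 %/ 4)%N.
have lE : l = (4 * n).+1.
  rewrite mulnC divnK // Kl prednK // prime_gt0 //; exact: pcharf_prime lK.
have E : IK ^+ dlog g (l%:R : 'F_p) * (J ^+ 3 * J') ^+ n = 1.
  apply: (fmorph_inj f); rewrite rmorphM [f (IK ^+ _)]rmorphXn [f ((_ * _) ^+ n)]rmorphXn rmorphM.
  rewrite [f (J ^+ 3)]rmorphXn rmorph1 /=.
  have -> : f J ^+ 3 * f J' = gauss e (chi g (f IK) 1) ^+ 4 by rewrite G4 -JJ; ring.
  rewrite -[_ ^+ 4 ^+ n]exprM; move: frob.
  rewrite (eq_gauss e (chi_eqmod g IP (j := l) (j' := 1) _)) ?l1 //.
  rewrite (chi_eqmod g IP (j := l) (j' := 1)) ?l1 //.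
  rewrite [in X in _ ^+ X]lE exprSr mulrA => /(canRL (mulfK G0)).
  by rewrite divff // /chi (negPf l0) mul1n.
move: E; rewrite dlog_quartic ?mulf_neq0 ?expf_neq0 // -exprD => /eqP.
rewrite (prim4_eq1 quartic_root_prim4) => d4.
have : (dlog h (J ^+ 3 * J')%R + dlog h (J * J' ^+ 3)%R = 0 %[mod 4])%N.
  rewrite -(dlogM4 hP K4) ?mulf_neq0 ?expf_neq0 //.
  rewrite (_ : J ^+ 3 * J' * (J * J' ^+ 3) = (J * J') ^+ 4); last by ring.
  by rewrite (dlogX4 hP K4) ?mulf_neq0 // mulnC modnMl.
move: d4; move: (dlog h _) (dlog h _) (dlog g _); clear=> a b c; lia.
Qed.

(** Frobenius sends I to - I, so J' = J ^ l.  Moreover G 1 ^ l is a multiple of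
    G 3, so it is G 1 ^ (l + 1) that can be compared with a power of
    G 1 ^ 4 = J ^ 2 * p. *)
Lemma reciprocity3 : #|K| = (l ^ 2)%N -> (l %% 4 = 3)%N ->
  dlog g (- l%:R : 'F_p) = dlog h J %[mod 4].
Proof.
move=> Kl l3; have cp := card_Fp pp; have h4 : (4 %| #|'F_p|.-1)%N by rewrite cp.
have [L [f [e [IP frob G13 [G4 JJ] G0]]]] := gauss_identities; have [J0 J'0] := jac_neq0.
have l0 : (l%:R : 'F_p) != 0.
  by rewrite -(dvdn_pcharf (pchar_Fp pp)) dvdn_prime2 //; exact: pcharf_prime lK.
have lL := rmorph_pchar f lK.
set I := f IK in IP frob G13 G4 JJ G0 *.
have Il : I ^+ l = - I.
  by rewrite -(prim_expr_mod IP) l3 (exprSr _ 2) (sqr_prim4 IP) mulN1r.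
have J'E : f J' = f J ^+ l.
  rewrite -(pFrobenius_autE lL) /J' /J !(rmorphD, rmorphB, rmorphM, rmorph_int) /=.
  by rewrite !pFrobenius_autE -/I Il mulrN rmorphN rmorphM rmorph_int.
have [nE nn] := exponent_3mod4 l3; set n := ((l + 1) %/ 4)%N in nE nn.
have chiM : chi g I 1 (- l%:R) = chi g I 1 (-1) * chi g I 1 l%:R.
  by rewrite -mulN1r; have [_ _ ->] := chi_mul_char gP h4 IP 1.
have chi13 : chi g I 1 l%:R * chi g I 3 l%:R = 1.
  by rewrite chi_mul /chi (negPf l0) exprM (prim_expr_order IP) expr1n.
have E : f J ^+ ((l - 1) * n) = chi g I 1 (- l%:R).
  have fJ0 : f J ^+ (l + 1) != 0 by rewrite expf_neq0 // fmorph_eq0.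
  apply: (mulIf fJ0); rewrite -exprD.
  rewrite nn exprM exprD exprD expr1.
  rewrite chiM -J'E (_ : f J' * f J = p%:R); last by rewrite mulrC.
  rewrite [RHS]mulrAC -G13 -G4 -exprM -nE.
  have -> : gauss e (chi g I 3) = chi g I 3 l%:R * gauss e (chi g I 1) ^+ l.
    rewrite (eq_gauss e (chi_eqmod g IP (j := 3) (j' := l) _)) ?l3 // -frob.
    by rewrite (chi_eqmod g IP (j := l) (j' := 3)) ?l3.
  by rewrite exprD expr1; transitivity ((chi g I 1 l%:R * chi g I 3 l%:R) *
     (gauss e (chi g I 1) ^+ l * gauss e (chi g I 1))); [rewrite chi13 mul1r | ring].
have : f (IK ^+ dlog h J) = f (IK ^+ dlog g (- l%:R : 'F_p)).
  rewrite -dlog_quartic // [f (J ^+ _)]rmorphXn [f (IK ^+ _)]rmorphXn /= -/I.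
  have -> : (#|K|.-1 %/ 4 = (l - 1) * n)%N.
    rewrite Kl (_ : (l ^ 2).-1 = (l - 1) * n * 4)%N ?mulnK //.
    by rewrite -mulnA [(n * 4)%N]mulnC -nE -(subn_sqr l 1) subn1.
  by rewrite E /chi oppr_eq0 (negPf l0) mul1n.
move/fmorph_inj/eqP; rewrite (eq_prim_root_expr quartic_root_prim4) => /eqP <- //.
Qed.
End Reciprocity.

(** * Local quartic symbols *)

Lemma dvdz_pchar (K : fieldType) (l : nat) (z : int) : l \in [pchar K] ->
  (l %| z)%Z = (z%:~R == 0 :> K).
Proof.
move=> lK; rewrite dvdzE absz_nat (dvdn_pcharf lK).
by case: z => n; rewrite ?NegzE ?abszN ?rmorphN ?oppr_eq0.
Qed.

Lemma sum_Fp (l : nat) (V : zmodType) (f : 'F_l -> V) : prime l ->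
  \sum_x f x = \sum_(c < l) f c%:R.
Proof.
move=> lp; rewrite (reindex (fun c : 'I_l => (c : nat)%:R : 'F_l)) //=.
exists (fun x : 'F_l => cast_ord (Fp_cast lp) x) => x _.
  by apply: val_inj; rewrite /= val_Fp_nat // modn_small.
by rewrite natr_Zp.
Qed.

Lemma eq_mod_intr (K : fieldType) (l : nat) (b b' : int) : l \in [pchar K] ->
  (b = b' %[mod l])%Z -> b%:~R = b'%:~R :> K.
Proof.
move=> lK /eqP; rewrite eqz_mod_dvd (dvdz_pchar _ lK) rmorphB /= subr_eq0.
by move/eqP.
Qed.

Definition tau1 (l : nat) : nat := if (l == 3 %[mod 4])%N then l else (l - 2)%N.

(** The value of the sum of 'i ^ (j k) over the classes modulo l, where k is the
    local symbol. *)
Definition local_sum (l j : nat) : int :=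
  if (4 %| j)%N then (tau1 l)%:Z else if (2 %| j)%N then -1
  else if (l %% 8)%N \in [:: 1; 7] then -1 else 1.

(** Here k a b stands for the exponent modulo 4 of the quartic residue symbol of
    a + b i modulo l, which is defined when l does not divide a ^ 2 + b ^ 2.  The
    cases l = 1 and l = 3 modulo 4, where l is split or inert in the Gaussian
    integers, satisfy this common interface by different constructions. *)
Record local_symbol (l : nat) (k : int -> int -> nat) : Prop := LocalSymbol {
  symbol_mod : forall a b b', (b = b' %[mod l])%Z -> k a b = k a b';
  symbol_opp : forall a b, ~~ (l %| a ^+ 2 + b ^+ 2)%Z -> k (- a) (- b) = k a b %[mod 4];
  symbol_conj : forall a b, ~~ (l %| a ^+ 2 + b ^+ 2)%Z ->
    k a (- b) = (3 * k a b)%N %[mod 4];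
  symbol_reciprocity : forall (p : nat) (g : 'F_p), prime p -> (4 %| p.-1)%N ->
    (#|'F_p|.-1).-primitive_root g -> p != l ->
    dlog g (if (l %% 4 == 1)%N then l%:R else - l%:R : 'F_p)
      = k (jac_re g) (jac_im g) %[mod 4];
  symbol_sum : forall a j, ~~ (l %| a)%Z ->
    \sum_(c < l | ~~ (l %| a ^+ 2 + c%:Z ^+ 2)%Z) 'i ^+ (j * k a c)
      = (local_sum l j)%:~R :> algC }.

Lemma half_quarter l : (l %% 4 = 1)%N -> (l.-1 %/ 2 = 2 * (l.-1 %/ 4))%N.
Proof. lia. Qed.

Lemma odd_quarter l : (l %% 4 = 1)%N ->
  odd (l.-1 %/ 4) = ((l %% 8)%N \notin [:: 1; 7]%N).
Proof. by rewrite !inE => l1; lia. Qed.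

(** The line A + x I is parametrized so that A + x I and A - x I become
    proportional to w and 1 - w. *)
Lemma sum_line_jacobi (F : finFieldType) (L : fieldType) (f : F -> L) (A I : F) :
  mul_char f -> (2 : F) != 0 -> A != 0 -> I != 0 ->
  \sum_x f (A + x * I) / f (A - x * I) = \sum_w f w / f (1 - w).
Proof.
move=> fc two A0 I0; have [_ _ fM] := fc.
rewrite (reindex (fun w => A * (2 * w - 1) / I)) /=; last first.
  by exists (fun x => (x * I / A + 1) / 2) => x _; field; rewrite ?A0 ?I0 ?two.
apply: eq_bigr => w _.
rewrite (_ : A + _ = 2 * A * w); last by field.
rewrite (_ : A - _ = 2 * A * (1 - w)); last by field.
have : f (2 * A) != 0 by apply: mul_char_neq0 (mulf_neq0 two A0).
by move: (2 * A) => B fB; rewrite !fM invfM mulrACA divff // mul1r.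
Qed.

Section Split.
Variable l : nat.
Hypotheses (lp : prime l) (l1 : (l %% 4 = 1)%N).
Variable h : 'F_l.
Hypothesis hP : (#|'F_l|.-1).-primitive_root h.
Let I := h ^+ (#|'F_l|.-1 %/ 4).

(** The product of the residue symbols of a + b i at the two primes above l; the
    symbol at the second prime is conjugated, which is the exponent 3. *)
Definition split_symbol (a b : int) : nat :=
  dlog h ((a%:~R + b%:~R * I) * (a%:~R - b%:~R * I) ^+ 3).

Let q4 : (4 %| #|'F_l|.-1)%N.
Proof. by rewrite card_Fp //; lia. Qed.

Let IP : 4.-primitive_root I.
Proof. exact: quartic_root_prim4 hP q4. Qed.

Let lK : l \in [pchar 'F_l] := pchar_Fp lp.

Let norm_neq0 a b : ~~ (l %| a ^+ 2 + b ^+ 2)%Z =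
  (a%:~R + b%:~R * I != 0) && (a%:~R - b%:~R * I != 0).
Proof.
rewrite (dvdz_pchar _ lK) -negb_or -mulf_eq0; congr (~~ (_ == 0)).
rewrite rmorphD !rmorphXn /=.
transitivity (a%:~R ^+ 2 - b%:~R ^+ 2 * I ^+ 2); last by ring.
by rewrite (sqr_prim4 IP); ring.
Qed.

(** The sum over the classes modulo l is, by [sum_line_jacobi], the Jacobi sum of a
    character and its inverse. *)
Lemma split_symbolP : local_symbol l split_symbol.
Proof.
split.
- by move=> a b b' /(eq_mod_intr lK) E; rewrite /split_symbol E.
- move=> a b _; rewrite /split_symbol; congr (dlog h _ %% 4)%N.
  by rewrite !rmorphN /=; ring.
- move=> a b; rewrite norm_neq0 => /andP [u0 v0]; rewrite /split_symbol rmorphN /=.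
  rewrite mulNr opprK; move: (_ + _) (_ - _) u0 v0 => u v u0 v0.
  rewrite -(dlogX4 hP q4) ?mulf_neq0 ?expf_neq0 //.
  rewrite (_ : (u * v ^+ 3) ^+ 3 = (v * u ^+ 3) * (v ^+ 2) ^+ 4); last by ring.
  by rewrite [RHS](dlogM4 hP q4) ?mulf_neq0 ?expf_neq0 // -[RHS]modnDmr (dlogX4 hP q4) ?expf_neq0 // modnMr addn0.
- move=> p g pp p4 gP pl; rewrite l1 /=.
  exact: (reciprocity1 pp p4 gP hP q4 lK pl (card_Fp lp)).
move=> a j la; have a0 : (a%:~R : 'F_l) != 0 by rewrite -(dvdz_pchar _ lK).
have C4 := Ci_prim4; set ch := chi h ('i : algC) j.
have [c0 c1 cM] : mul_char ch := chi_mul_char hP q4 C4 j.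
have cX x : x != 0 -> ch (x ^+ 3) = (ch x)^-1.
  move=> x0; have e : ch (x ^+ 3) * ch x = 1.
    rewrite -cM -exprSr /ch /chi expf_eq0 /= (negPf x0); apply/eqP.
    by rewrite (prim4_eq1 C4) dvdn_mull // /dvdn (dlogX4 hP q4) // modnMr.
  have chx : ch x != 0 by apply: mul_char_neq0 x0; split.
  by rewrite -[RHS]mul1r -e mulfK.
pose A : 'F_l := a%:~R.
have -> : \sum_(c < l | ~~ (l %| a ^+ 2 + c%:Z ^+ 2)%Z) 'i ^+ (j * split_symbol a c)
   = \sum_(x : 'F_l) ch (A + x * I) / ch (A - x * I).
  rewrite sum_Fp // big_mkcond; apply: eq_bigr => c _; rewrite norm_neq0 -/A.
  rewrite /split_symbol -/A -[c%:Z%:~R]/(c%:R).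
  have [u0|u0] := eqVneq (A + c%:R * I) 0; first by rewrite u0 /= c0 mul0r.
  have [v0|v0] := eqVneq (A - c%:R * I) 0; first by rewrite v0 c0 invr0 mulr0 andbF.
  rewrite /= -(cX _ v0).
  by rewrite -cM /ch /chi (negPf (mulf_neq0 u0 (expf_neq0 3 v0))).
have chc : mul_char ch := chi_mul_char hP q4 C4 j.
rewrite (sum_line_jacobi chc (two_neq0 IP) a0 (prim_root_neq0 IP)).
rewrite /local_sum; case: ifP => j4; last first.
  rewrite /ch (jacobi_conj_sum hP q4 C4) ?j4 // /chi oppr_eq0 oner_eq0 /=.
  rewrite -(prim_expr_mod C4) -modnMmr (dlogN14 hP q4) modnMmr card_Fp //.
  rewrite (half_quarter l1) mulnCA (prim_expr_mod C4) exprM (sqr_prim4 C4).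
  rewrite -signr_odd oddM (odd_quarter l1) dvdn2.
  by case: (odd j) => /=; case: ((l %% 8)%N \in [:: 1; 7]%N); rewrite /= ?expr0 ?expr1 ?opprK ?rmorphN1.
have ch1 x : x != 0 -> ch x = 1.
  by move=> x0; rewrite /ch /chi (negPf x0); apply/eqP; rewrite (prim4_eq1 C4) dvdn_mulr.
rewrite (bigD1 0) //= c0 mul0r add0r (bigD1 1) ?oner_neq0 //= subrr c0 invr0 mulr0 add0r.
rewrite (eq_bigr (fun => 1)) => [|w /andP [w0 w1]]; last first.
  by rewrite !ch1 ?invr1 ?mulr1 // subr_eq0 eq_sym.
have : \sum_(w : 'F_l) (1 : algC) = l%:R by rewrite sumr_const card_Fp.
rewrite (bigD1 0) //= (bigD1 1) ?oner_neq0 //= => E.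
rewrite /tau1 l1 /= [RHS]natrB ?prime_gt1 // -E; ring.
Qed.
End Split.

Lemma inert_quarter l : (l %% 4 = 3)%N ->
  (((l - 1) * (l + 1) %/ 4) %% 4 = if l %% 8 \in [:: 1; 7] then 0 else 2)%N.
Proof.
move=> l3; rewrite !inE.
have [l8|l8] : (l %% 8 = 3 \/ l %% 8 = 7)%N by lia.
  rewrite l8 /=; have [m ->] : exists m, l = (8 * m + 3)%N by exists (l %/ 8)%N; lia.
  rewrite (_ : (8 * m + 3 - 1) * (8 * m + 3 + 1) = ((4 * m * m + 3 * m) * 4 + 2) * 4)%N.
    by rewrite mulnK // modnMDl.
  by rewrite (_ : 8 * m + 3 - 1 = 8 * m + 2)%N; lia.
rewrite l8 /=; have [m ->] : exists m, l = (8 * m + 7)%N by exists (l %/ 8)%N; lia.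
rewrite (_ : (8 * m + 7 - 1) * (8 * m + 7 + 1) = ((4 * m + 3) * (m + 1) * 4) * 4)%N.
  by rewrite mulnK // modnMl.
by rewrite (_ : 8 * m + 7 - 1 = 8 * m + 6)%N; lia.
Qed.

Section Inert.
Variable l : nat.
Hypotheses (lp : prime l) (l3 : (l %% 4 = 3)%N).
Variables (K : finFieldType) (h : K).
Hypotheses (lK : l \in [pchar K]) (cK : #|K| = (l ^ 2)%N)
  (hP : (#|K|.-1).-primitive_root h).
Let I := h ^+ (#|K|.-1 %/ 4).

(** The residue field of the inert prime l is K, with l ^ 2 elements. *)
Definition inert_symbol (a b : int) : nat := dlog h (a%:~R + b%:~R * I).

Let cK1 : #|K|.-1 = ((l - 1) * (l + 1))%N.
Proof. by rewrite cK -subn1 -(subn_sqr l 1). Qed.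

Let q4 : (4 %| #|K|.-1)%N.
Proof. by rewrite cK1 dvdn_mull //; move: l3; clear; lia. Qed.

Let IP : 4.-primitive_root I.
Proof. exact: quartic_root_prim4 hP q4. Qed.

Let Il : I ^+ l = - I.
Proof. by rewrite -(prim_expr_mod IP) l3 (exprSr _ 2) (sqr_prim4 IP) mulN1r. Qed.

Let conjE a b : a%:~R - b%:~R * I = (a%:~R + b%:~R * I) ^+ l.
Proof.
rewrite -(pFrobenius_autE lK) rmorphD rmorphM !rmorph_int /=.
by rewrite pFrobenius_autE Il mulrN.
Qed.

Let emb (x : 'F_l) : K := (x : nat)%:R.

(** I is not in the prime field, since Frobenius does not fix it. *)
Let indep (x y : 'F_l) : emb x + emb y * I = 0 :> K -> x = 0 /\ y = 0.
Proof.
have inj0 (z : 'F_l) : emb z = 0 -> z = 0.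
  move/eqP; rewrite /emb -(dvdn_pcharf lK) (dvdn_pcharf (pchar_Fp lp)).
  by rewrite natr_Zp => /eqP.
have Fn (n : nat) : (n%:R : K) ^+ l = n%:R by rewrite -(pFrobenius_autE lK) rmorph_nat.
move=> h0; have h1 : emb x - emb y * I = 0 :> K.
  have := congr1 (fun z => z ^+ l) h0.
  rewrite /emb -!(pFrobenius_autE lK) rmorphD rmorphM !rmorph_nat rmorph0 /=.
  by rewrite pFrobenius_autE Il mulrN.
have two := two_neq0 IP.
have x0 : emb x = 0 :> K.
  have /eqP : 2 * emb x = 0 :> K.
    transitivity ((emb x + emb y * I) + (emb x - emb y * I)).
      by ring.
    by rewrite h0 h1 addr0.
  by rewrite mulf_eq0 (negPf two) => /eqP.
split; first exact: inj0.
apply: inj0; apply/eqP; move/eqP: h0; rewrite x0 add0r mulf_eq0.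
by rewrite (negPf (prim_root_neq0 IP)) orbF.
Qed.

Let embM (x y : 'F_l) : emb (x * y) = emb x * emb y.
Proof.
rewrite /emb -natrM -[in LHS](natr_Zp x) -[in LHS](natr_Zp y) -natrM val_Fp_nat //.
by rewrite GRing.natr_mod_pchar.
Qed.

Let embB (x y : 'F_l) : emb (x - y) = emb x - emb y.
Proof.
have embD (u v : 'F_l) : emb (u + v) = emb u + emb v.
  rewrite /emb -natrD -[in LHS](natr_Zp u) -[in LHS](natr_Zp v) -natrD val_Fp_nat //.
  by rewrite GRing.natr_mod_pchar.
by apply/eqP; rewrite eq_sym subr_eq -embD subrK.
Qed.

Let sum_plane (f : K -> algC) :
  \sum_z f z = \sum_(x : 'F_l) \sum_(y : 'F_l) f (emb x + emb y * I).
Proof.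
rewrite pair_big /=.
pose em (u : 'F_l * 'F_l) : K := emb u.1 + emb u.2 * I.
have em_inj : injective em.
  move=> [x y] [x' y'] /eqP; rewrite /em /= -subr_eq0 => /eqP E.
  have [] := indep (x := x - x') (y := y - y').
    by rewrite !embB -[RHS]E; ring.
  by move=> /subr0_eq -> /subr0_eq ->.
have card_em : #|{: 'F_l * 'F_l}| = #|K| by rewrite card_prod card_Fp // cK.
have [em' emK em'K] := inj_card_bij em_inj (eq_leq (esym card_em)).
by rewrite (reindex em) //; exists em' => x _.
Qed.

(** A quartic character of K is trivial on the prime field, because
    (l ^ 2 - 1) / 4 is a multiple of l - 1.  Its vanishing sum over K is then
    l - 1 times its sum over the points of the projective line over F_l, that is
    over the a + y I and the point I, so the sum over the a + y I is minus its
    value at I. *)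
Lemma inert_symbolP : local_symbol l inert_symbol.
Proof.
have C4 := Ci_prim4.
have u_neq0 a b : ~~ (l %| a ^+ 2 + b ^+ 2)%Z -> a%:~R + b%:~R * I != 0.
  apply: contraNneq => u0; rewrite (dvdz_pchar _ lK) rmorphD !rmorphXn /=.
  apply/eqP; rewrite -[RHS](mul0r (a%:~R - b%:~R * I)) -u0.
  transitivity (a%:~R ^+ 2 - b%:~R ^+ 2 * I ^+ 2 : K); last by ring.
  by rewrite (sqr_prim4 IP); ring.
split.
- by move=> a b b' /(eq_mod_intr lK) E; rewrite /inert_symbol E.
- move=> a b /u_neq0 u0; rewrite /inert_symbol !rmorphN /= mulNr -opprD -mulN1r.
  rewrite (dlogM4 hP q4) ?oppr_eq0 ?oner_neq0 // -modnDml (dlogN14 hP q4) cK1.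
  rewrite (_ : (_ %/ 2) %% 4 = 0)%N // (_ : (l - 1) * (l + 1) = ((l - 1) %/ 2) * ((l + 1) %/ 4) * 4 * 2)%N.
    by rewrite mulnK // modnMl.
  have e1 : (l - 1 = (l - 1) %/ 2 * 2)%N by move: l3; clear; lia.
  have e2 : (l + 1 = (l + 1) %/ 4 * 4)%N by move: l3; clear; lia.
  by rewrite {1}e1 {1}e2; ring.
- move=> a b /u_neq0 u0; rewrite /inert_symbol rmorphN /= mulNr conjE.
  by rewrite (dlogX4 hP q4) // -modnMml l3.
- move=> p g pp p4 gP pl; rewrite l3 /=.
  exact: (reciprocity3 pp p4 gP hP q4 lK pl cK l3).
move=> a j la; pose x0 : 'F_l := a%:~R.
have x00 : x0 != 0 by rewrite /x0 -(dvdz_pchar _ (pchar_Fp lp)).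
have ea : emb x0 = a%:~R.
  apply/eqP; rewrite /emb -subr_eq0 -(rmorph_nat (intr : int -> K)) -rmorphB /=.
  rewrite -(dvdz_pchar _ lK) (dvdz_pchar _ (pchar_Fp lp)) rmorphB /= subr_eq0.
  by rewrite rmorph_nat natr_Zp.
pose ch : K -> algC := chi h 'i j.
have chc : mul_char ch := chi_mul_char hP q4 C4 j; have [c0 c1 cM] := chc.
have line0 y : emb x0 + emb y * I != 0.
  by apply: contra_neq x00 => /indep [].
pose S := \sum_(y : 'F_l) ch (emb x0 + emb y * I).
have -> : \sum_(c < l | ~~ (l %| a ^+ 2 + c%:Z ^+ 2)%Z) 'i ^+ (j * inert_symbol a c) = S.
  rewrite /S sum_Fp // big_mkcond; apply: eq_bigr => c _.
  have := line0 c%:R; rewrite ea (_ : emb c%:R = (c%:Z)%:~R); last first.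
    by rewrite /emb val_Fp_nat // GRing.natr_mod_pchar.
  move=> u0; rewrite /ch /chi (negPf u0) ifT //.
  rewrite (dvdz_pchar _ lK) rmorphD !rmorphXn /=.
  have -> : a%:~R ^+ 2 + c%:Z%:~R ^+ 2 = (a%:~R + c%:Z%:~R * I) * (a%:~R - c%:Z%:~R * I).
    transitivity (a%:~R ^+ 2 - c%:Z%:~R ^+ 2 * I ^+ 2 : K); last by ring.
    by rewrite (sqr_prim4 IP); ring.
  by rewrite conjE mulf_neq0 ?expf_neq0.
have emb0 : emb 0 = 0 by [].
have emb_neq0 w : w != 0 -> emb w != 0.
  move=> w0; apply: contra_neq w0 => e0; have [] := indep (x := w) (y := 0) => //.
  by rewrite e0 emb0 mul0r addr0.
have ch_emb w : w != 0 -> ch (emb w) = 1.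
  move=> w0; have e0 := emb_neq0 w w0.
  have el : emb w ^+ (l - 1) = 1.
    apply: (mulIf e0); rewrite -exprSr mul1r subn1 prednK ?prime_gt0 //.
    by rewrite -(pFrobenius_autE lK) rmorph_nat.
  have : emb w ^+ (#|K|.-1 %/ 4) = 1.
    rewrite cK1 -muln_divA; last by move: l3; clear; lia.
    by rewrite exprM el expr1n.
  rewrite (dlog_quartic hP e0) -/I => /eqP; rewrite (prim4_eq1 IP) => d4.
  by rewrite /ch /chi (negPf e0); apply/eqP; rewrite (prim4_eq1 C4) dvdn_mull.
have lE : \sum_(w : 'F_l) (1 : algC) = l%:R by rewrite sumr_const card_Fp.
rewrite /local_sum; case: ifP => j4.
  rewrite /tau1 l3 /= -[RHS]/(l%:R) -lE; apply: eq_bigr => y _.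
  by rewrite /ch /chi (negPf (line0 y)); apply/eqP; rewrite (prim4_eq1 C4) dvdn_mulr.
have : \sum_z ch z = 0 by rewrite (sum_chi hP q4 C4) ?j4.
have I0 := prim_root_neq0 IP.
have lE1 : \sum_(w : 'F_l | w != 0) (1 : algC) = l%:R - 1.
  by rewrite -lE [in RHS](bigD1 0) //= addrAC subrr add0r.
have line_sum x : x != 0 -> \sum_(y : 'F_l) ch (emb x + emb y * I) = 1 * S.
  move=> xn; rewrite mul1r (reindex (fun y => x / x0 * y)) /=; last first.
    by exists (fun y => x0 / x * y) => y _; field; rewrite x00 xn.
  apply: eq_bigr => y _; set w := x / x0; have w0 : w != 0 by rewrite mulf_neq0 ?invr_eq0.
  rewrite (_ : x = w * x0); last by rewrite divfK.
  by move: w w0 => w w0; rewrite !embM -mulrA -mulrDr cM ch_emb ?mul1r.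
rewrite sum_plane (bigD1 0) //= [X in _ + X](eq_bigr (fun=> 1 * S)) => [|x xn]; last exact: line_sum.
rewrite -mulr_suml lE1 (bigD1 0) //= emb0 mul0r addr0 c0 add0r.
rewrite (eq_bigr (fun=> 1 * ch I)) => [|y y0]; last by rewrite add0r cM ch_emb.
rewrite -mulr_suml lE1 -mulrDr => /eqP; rewrite mulf_eq0 subr_eq0 => /orP [].
  by rewrite (eqr_nat _ l 1) => /eqP l1; move: lp; rewrite l1.
rewrite addrC addr_eq0 => /eqP ->.
rewrite /ch /chi (negPf I0) -(prim_expr_mod C4) -modnMmr.
have -> : (dlog h I %% 4 = if l %% 8 \in [:: 1; 7] then 0 else 2)%N.
  have /(congr1 (modn^~ 4)) := dlog_expr hP (#|K|.-1 %/ 4).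
  by rewrite !modn_dvdm // -/I => ->; rewrite cK1 inert_quarter.
case: ifP => _; first by rewrite muln0 expr0 if_same rmorphN1.
rewrite (prim_expr_mod C4) mulnC exprM (sqr_prim4 C4) -signr_odd dvdn2.
by case: odd; rewrite /= ?expr0 ?expr1 ?opprK ?rmorphN1.
Qed.
End Inert.

Theorem exists_local_symbol l : prime l -> odd l -> exists k, local_symbol l k.
Proof.
move=> lp lo; have [l1|l3] : (l %% 4 = 1 \/ l %% 4 = 3)%N by lia.
  by have [h hP] := exists_primitive_root 'F_l; exists (split_symbol h); apply: split_symbolP.
have [K lK cK] := pPrimePowerField lp (isT : 0 < 2)%N.
have [h hP] := exists_primitive_root K.
by exists (inert_symbol h); apply: inert_symbolP.
Qed.

(** * Counting residue classes by their global symbol *)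

Lemma sum_chinese (R : comNzRingType) (m n : nat) (f g : nat -> R) :
  coprime m n -> (0 < m)%N -> (0 < n)%N ->
  (forall c, f (c %% m)%N = f c) -> (forall c, g (c %% n)%N = g c) ->
  \sum_(c < m * n) f c * g c = (\sum_(c < m) f c) * (\sum_(c < n) g c).
Proof.
move=> mn m0 n0 fm gn; rewrite big_distrlr pair_big /=.
have mn0 : (0 < m * n)%N by rewrite muln_gt0 m0.
rewrite [RHS](reindex (fun c : 'I_(m * n) =>
  (Ordinal (ltn_pmod c m0), Ordinal (ltn_pmod c n0)))) /=; last first.
  exists (fun u : 'I_m * 'I_n => Ordinal (ltn_pmod (chinese m n u.1 u.2) mn0)) => [c _|[a b] _].
    apply: val_inj; rewrite /= -[RHS](modn_small (ltn_ord c)); apply/eqP.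
    rewrite chinese_remainder //.
    by rewrite chinese_modl // chinese_modr // !modn_mod !eqxx.
  congr pair; apply: val_inj => /=.
    by rewrite modn_dvdm ?dvdn_mulr // chinese_modl // modn_small.
  by rewrite modn_dvdm ?dvdn_mull // chinese_modr // modn_small.
by apply: eq_bigr => c _; rewrite fm gn.
Qed.

Lemma dvdz_norm_mod (l : nat) (a x y : int) : (x = y %[mod l])%Z ->
  (l %| a ^+ 2 + x ^+ 2)%Z = (l %| a ^+ 2 + y ^+ 2)%Z.
Proof.
move=> /eqP; rewrite eqz_mod_dvd => xy.
rewrite (_ : a ^+ 2 + x ^+ 2 = (a ^+ 2 + y ^+ 2) + (x - y) * (x + y)); last by ring.
by rewrite rpredDr // dvdz_mulr.
Qed.

Section GlobalSymbol.
Variable k : nat -> int -> int -> nat.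
Variable a : int.

(** A list of pairs (l, e) stands for the product of the prime powers l ^ e. *)
Implicit Type W : seq (nat * nat).

Definition good_residue W (x : int) :=
  all (fun w : nat * nat => ~~ (w.1 %| a ^+ 2 + x ^+ 2)%Z) W.

Definition global_symbol W (b x : int) : nat := (\sum_(w <- W) w.2 * k w.1 b x)%N.

Definition modulus W : nat := (\prod_(w <- W) w.1)%N.

Definition symbols_for W := forall w, w \in W ->
  [/\ prime w.1, odd w.1, ~~ (w.1 %| a)%Z & local_symbol w.1 (k w.1)].

Lemma modulus_gt0 W : symbols_for W -> (0 < modulus W)%N.
Proof.
move=> hW; rewrite /modulus big_seq prodn_cond_gt0 // => w /hW [lp _ _ _].
exact: prime_gt0.
Qed.

Lemma coprime_modulus W (l : nat) : symbols_for W -> prime l -> odd l ->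
  l \notin map fst W -> coprime (4 * modulus W) l.
Proof.
move=> hW lp lo lW; rewrite coprime_sym coprimeMr; apply/andP; split.
  rewrite prime_coprime // -[4%N]/(2 ^ 2)%N Euclid_dvdX //= andbT dvdn_prime2 //.
  by apply: contraTneq lo => ->.
rewrite /modulus big_seq; apply: (big_ind (fun x => coprime l x)) => [|x y|w wW]; first exact: coprimen1.
  by rewrite coprimeMr => -> ->.
have [wp _ _ _] := hW w wW; rewrite prime_coprime // dvdn_prime2 //.
by apply: contraNneq lW => ->; apply: map_f.
Qed.

(** Both factors of the summand are periodic, so the Chinese remainder theorem
    splits off one prime at a time. *)
Lemma sum_global_symbol W (G : nat -> algC) j : symbols_for W -> uniq (map fst W) ->
  (forall c, G (c %% 4)%N = G c) ->
  \sum_(c < 4 * modulus W | good_residue W c) G c * 'i ^+ (j * global_symbol W a c)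
  = (\sum_(c < 4) G c) * \prod_(w <- W) (local_sum w.1 (j * w.2))%:~R.
Proof.
move=> hW uW G4; rewrite big_mkcond /=.
pose f W (c : nat) : algC :=
  if good_residue W c then G c * 'i ^+ (j * global_symbol W a c) else 0.
rewrite -[LHS]/(\sum_(c < 4 * modulus W) f W c).
suff [-> //] : \sum_(c < 4 * modulus W) f W c =
    (\sum_(c < 4) G c) * \prod_(w <- W) (local_sum w.1 (j * w.2))%:~R /\
    forall c, f W (c %% (4 * modulus W))%N = f W c.
elim: W hW uW => [|w W IH] hW uW.
  rewrite big_nil mulr1 /modulus big_nil muln1; split=> [|c].
    by apply: eq_bigr => c _; rewrite /f /= /global_symbol big_nil muln0 expr0 mulr1.
  by rewrite /f /= /global_symbol !big_nil muln0 expr0 !mulr1 G4.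
have hW' : symbols_for W by move=> v vW; apply: hW; rewrite inE vW orbT.
have /andP [wW uW'] := uW; have {IH} [IH per] := IH hW' uW'.
have [lp lo la ls] := hW w (mem_head _ _).
pose g (c : nat) : algC :=
  if ~~ (w.1 %| a ^+ 2 + c%:Z ^+ 2)%Z then 'i ^+ (j * w.2 * k w.1 a c) else 0.
have fE c : f (w :: W) c = f W c * g c.
  rewrite /f /g /= /global_symbol big_cons; case: (~~ _) => /=; last by rewrite mulr0.
  case: (good_residue W c); last by rewrite mul0r.
  by rewrite mulnDr exprD mulnA mulrCA mulrC.
have gper c : g (c %% w.1)%N = g c.
  have cc : ((c %% w.1)%N = c %[mod w.1])%Z by rewrite -modz_nat modz_mod.
  rewrite /g (symbol_mod ls a cc); congr (if ~~ _ then _ else _).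
  exact: dvdz_norm_mod cc.
have mE : (4 * modulus (w :: W) = 4 * modulus W * w.1)%N.
  by rewrite /modulus big_cons; ring.
have m0 : (0 < 4 * modulus W)%N by rewrite muln_gt0 modulus_gt0.
split; last first.
  move=> c; rewrite !fE mE; congr (_ * _).
    by rewrite -[LHS]per (modn_dvdm _ (dvdn_mulr _ (dvdnn _))); exact: per.
  by rewrite -[LHS]gper (modn_dvdm _ (dvdn_mull _ (dvdnn _))); exact: gper.
rewrite mE (eq_bigr (fun c : 'I__ => f W c * g c)); last by move=> c _; exact: fE.
rewrite (sum_chinese (coprime_modulus hW' lp lo wW) m0 (prime_gt0 lp) per gper) IH.
rewrite big_cons -mulrA [X in _ * X]mulrC; congr (_ * (_ * _)).
rewrite -(symbol_sum ls _ la) [RHS]big_mkcond; by apply: eq_bigr => c _.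
Qed.

(** The symbol is prescribed to be 2 t for the classes 0 modulo 4 and 2 t' for the
    classes 2 modulo 4.  The condition is detected by the four characters of
    Z / 4; as 2 t = - 2 t modulo 4, it may be added to the symbol instead of being
    subtracted. *)
Lemma count_global_symbol W (t t' : bool) : symbols_for W -> uniq (map fst W) ->
  let X j := \prod_(w <- W) local_sum w.1 (j * w.2) in
  4 * (\sum_(c < 4 * modulus W | good_residue W c && ~~ odd c)
        (global_symbol W a c == (if (4 %| c)%N then 2 * t else 2 * t')%N %[mod 4])%N)%:Z
  = \sum_(j < 4) ((-1) ^+ (j * t) + (-1) ^+ (j * t')) * X j.
Proof.
move=> hW uW X; have C4 := Ci_prim4; apply: (@intr_inj algC).
pose tt c := (if (4 %| c)%N then 2 * t else 2 * t')%N.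
pose G j (c : nat) : algC := if odd c then 0 else 'i ^+ (j * tt c).
have Gper j c : G j (c %% 4)%N = G j c.
  rewrite /G /tt /dvdn modn_mod; congr (if _ then _ else _).
  by rewrite -[in RHS](@odd_mod c 4 erefl).
have GS j : \sum_(c < 4) G j c = ((-1) ^+ (j * t) + (-1) ^+ (j * t')) %:~R.
  rewrite !big_ord_recl big_ord0 /G /tt /= !add0r addr0 mulnCA [(j * (2 * t'))%N]mulnCA.
  by rewrite ![_ ^+ (2 * _)]exprM (sqr_prim4 C4) rmorphD !rmorphXn /= rmorphN1.
transitivity (\sum_(j < 4) \sum_(c < 4 * modulus W | good_residue W c)
    G j c * 'i ^+ (j * global_symbol W a c)).
  rewrite exchange_big /= rmorphM /= -[X in _ * X]/(_%:R) natr_sum mulr_sumr.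
  rewrite big_mkcondr; apply: eq_bigr => c _.
  rewrite /G; case: (odd c) => /=.
    by rewrite big1 // => j _; rewrite mul0r.
  rewrite -/(tt c); set s := global_symbol W a c.
  have -> : (s == tt c %[mod 4])%N = (4 %| tt c + s)%N.
    by rewrite /tt; case: (4 %| c)%N; case: t {tt G Gper GS}; case: t'; lia.
  have red j : 'i ^+ (j * tt c) * 'i ^+ (j * s) = 'i ^+ ((j * ((tt c + s) %% 4)) %% 4) :> algC.
    by rewrite modnMmr (prim_expr_mod C4) mulnDr exprD.
  under [RHS]eq_bigr do rewrite red.
  rewrite !big_ord_recl big_ord0 /= /dvdn.
  by case: (mod4_cases (tt c + s)) => -> /=; have i2 : 'i ^+ 2 = -1 :> algC := sqr_prim4 C4; ring: i2.
rewrite rmorph_sum; apply: eq_bigr => j _ /=.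
by rewrite sum_global_symbol // GS rmorphM /= rmorph_prod.
Qed.
End GlobalSymbol.

(** * The trace as a condition on a residue class *)

Section TraceSymbol.
Variable k : nat -> int -> int -> nat.
Variable alpha : int.
Hypothesis ha : (alpha = 1 %[mod 4])%Z.
Implicit Type W : seq (nat * nat).

(** Passing to another square root of a ^ 2 or of b ^ 2 either preserves all local
    symbols or conjugates all of them. *)
Lemma global_symbol_conj W (A B a b : int) : symbols_for k alpha W ->
  all (fun w : nat * nat => ~~ (w.1 %| a ^+ 2 + b ^+ 2)%Z) W ->
  A ^+ 2 = a ^+ 2 -> B ^+ 2 = b ^+ 2 ->
  (global_symbol k W A B = global_symbol k W a b %[mod 4])%N \/
  (global_symbol k W A B = 3 * global_symbol k W a b %[mod 4])%N.
Proof.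
move=> hW gW eA eB.
have H (s : nat) : (forall w : nat * nat, w \in W -> k w.1 A B = s * k w.1 a b %[mod 4])%N ->
    (global_symbol k W A B = s * global_symbol k W a b %[mod 4])%N.
  rewrite /global_symbol; elim: W {hW gW} => [|w W IH] h.
    by rewrite !big_nil muln0.
  rewrite !big_cons mulnDr -modnDm -[RHS]modnDm IH; last first.
    by move=> v vW; apply: h; rewrite inE vW orbT.
  by congr ((_ + _) %% _)%N; rewrite -modnMmr h ?mem_head // modnMmr mulnCA.
have g w : w \in W -> ~~ (w.1 %| a ^+ 2 + b ^+ 2)%Z by move=> /(allP gW).
have hA : A = a \/ A = - a by move/eqP: eA; rewrite eqf_sqr => /orP [] /eqP; tauto.
have hB : B = b \/ B = - b by move/eqP: eB; rewrite eqf_sqr => /orP [] /eqP; tauto.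
move: H; case: hA => ->; case: hB => -> H.
- by left.
- by right; apply: H => w wW; have [_ _ _ ls] := hW w wW; apply: (symbol_conj ls); apply: g.
- right; apply: H => w wW; have [_ _ _ ls] := hW w wW; have gw := g w wW.
  have gw' : ~~ (w.1 %| a ^+ 2 + (- b) ^+ 2)%Z by rewrite sqrrN.
  by rewrite -{1}[b]opprK (symbol_opp ls gw') (symbol_conj ls gw).
- left; have := H 1%N; rewrite mul1n; apply=> w wW; rewrite mul1n.
  by have [_ _ _ ls] := hW w wW; apply: (symbol_opp ls); apply: g.
Qed.

(** The associate of the odd prime l that is congruent to 1 modulo 4, for which
    reciprocity has no sign. *)
Definition primary_prime (l : nat) : int := if (l %% 4 == 1)%N then l%:Z else - l%:Z.

Lemma dlog_primary_prod W (p : nat) (g : 'F_p) : symbols_for k alpha W ->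
  prime p -> (4 %| p.-1)%N -> (#|'F_p|.-1).-primitive_root g ->
  p \notin map fst W ->
  dlog g ((\prod_(w <- W) primary_prime w.1 ^+ w.2)%:~R : 'F_p)
   = global_symbol k W (jac_re g) (jac_im g) %[mod 4].
Proof.
move=> hW pp p4 gP; have h4 : (4 %| #|'F_p|.-1)%N by rewrite card_Fp.
rewrite /global_symbol; elim: W hW => [|w W IH] hW pW.
  by rewrite !big_nil (dlog14 gP h4).
move: pW; rewrite inE negb_or => /andP [pw pW].
have [lp lo _ ls] := hW w (mem_head _ _).
have nz (v : nat) : prime v -> p != v -> ((primary_prime v)%:~R : 'F_p) != 0.
  move=> vp pv; rewrite /primary_prime; case: ifP => _; rewrite ?rmorphN ?oppr_eq0 /=;
  by rewrite -(dvdn_pcharf (pchar_Fp pp)) dvdn_prime2.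
have hW' : symbols_for k alpha W by move=> v vW; apply: hW; rewrite inE vW orbT.
have nzW : ((\prod_(w <- W) primary_prime w.1 ^+ w.2)%:~R : 'F_p) != 0.
  rewrite rmorph_prod /= prodf_seq_neq0; apply/allP => v vW /=.
  have [vp _ _ _] := hW' v vW; rewrite rmorphXn expf_neq0 // nz //.
  by apply: contraNneq pW => ->; apply: map_f.
rewrite !big_cons rmorphM rmorphXn /= (dlogM4 gP h4) ?expf_neq0 ?nz //.
have E : dlog g ((primary_prime w.1)%:~R : 'F_p) = k w.1 (jac_re g) (jac_im g) %[mod 4].
  rewrite -(symbol_reciprocity ls pp p4 gP pw) /primary_prime.
  by case: ifP => _; rewrite ?rmorphN.
rewrite -[LHS]modnDm IH // (dlogX4 gP h4) ?nz // -[(w.2 * _ %% 4)%N]modnMmr E modnMmr.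
exact: modnDm.
Qed.

Lemma primary_prod_mod4 W : (forall w, w \in W -> odd w.1) ->
  (\prod_(w <- W) primary_prime w.1 ^+ w.2 = 1 %[mod 4])%Z.
Proof.
elim: W => [|w W IH] hW; first by rewrite big_nil.
rewrite big_cons -modzMm IH; last by move=> v vW; apply: hW; rewrite inE vW orbT.
rewrite -modzXm (_ : (primary_prime w.1 %% 4)%Z = 1) ?expr1n //.
by have := hW w (mem_head _ _); rewrite /primary_prime; case: ifP; move: (w.1) => l; lia.
Qed.

Lemma primary_prodE W (d : int) : (forall w, w \in W -> odd w.1) ->
  `|d|%N = (\prod_(w <- W) w.1 ^ w.2)%N ->
  d = (if (d %% 4 == 1)%Z then 1 else -1) * \prod_(w <- W) primary_prime w.1 ^+ w.2.
Proof.
move=> hW dE; have := primary_prod_mod4 hW; set P := \prod_(w <- W) _ => P4.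
have : `|P|%N = `|d|%N.
  rewrite dE /P; elim: W {hW dE P P4} => [|w W IH]; first by rewrite !big_nil.
  rewrite !big_cons abszM IH abszX; congr (_ ^ _ * _)%N.
  by rewrite /primary_prime; case: ifP; rewrite ?abszN.
by case: ifP; move: P P4 => P; clear; lia.
Qed.

Lemma dlogN1_two_squares (p : nat) (g : 'F_p) (x : int) : prime p -> (4 %| p.-1)%N ->
  (#|'F_p|.-1).-primitive_root g -> p%:Z = alpha ^+ 2 + x ^+ 2 -> (2 %| x)%Z ->
  dlog g (-1) = (if (4 %| x)%Z then 0 else 2)%N %[mod 4].
Proof.
move=> pp p4 gP px x2; have h4 : (4 %| #|'F_p|.-1)%N by rewrite card_Fp.
rewrite (dlogN14 gP h4) card_Fp //; have p0 := prime_gt0 pp; move: p0 px x2 ha; clear.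
move=> p0 px x2 ha.
have [m mE] : exists m, alpha = 4 * m + 1 by exists (alpha %/ 4)%Z; lia.
have mod4 (u v z : int) : p%:Z = 1 + 8 * u + 16 * v + 4 * z ->
    ((p.-1 %/ 2) %% 4)%N = `|((2 * z) %% 4)%Z|%N by lia.
case: ifP => x4.
  have [z zE] : exists z, x = 4 * z by exists (x %/ 4)%Z; lia.
  rewrite (mod4 m (m ^+ 2 + z ^+ 2) 0) ?px ?mE ?zE //; ring.
have [z zE] : exists z, x = 4 * z + 2 by exists (x %/ 4)%Z; lia.
rewrite (mod4 m (m ^+ 2 + z ^+ 2 + z) 1) ?px ?mE ?zE //; ring.
Qed.

(** If d is 3 modulo 4, then chi d is chi (-1) times the global symbol, and
    chi (-1) is -1 exactly when x is 2 modulo 4.  This is also when the sign in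
    [trace_criterion] changes, and the two effects cancel; if d is 1 modulo 4, only
    the second one is present. *)
Lemma trace_symbol W (p : nat) (d x : int) (s : bool) : symbols_for k alpha W ->
  prime p -> p%:Z = alpha ^+ 2 + x ^+ 2 -> (2 %| x)%Z ->
  (2 %| d)%Z = false -> `|d|%N = (\prod_(w <- W) w.1 ^ w.2)%N -> p \notin map fst W ->
  let b := (d %% 4 == 1)%Z in
  (E_trace (4 * d) p == 2 * (if s then - alpha else alpha)) =
  (global_symbol k W alpha x == (if (4 %| x)%Z then 2 * s else 2 * (b (+) s))%N %[mod 4])%N.
Proof.
move=> hW pp px x2 d2 dE pW b.
have p4 : (4 %| p.-1)%N.
  have [m mE] : exists m, alpha = 4 * m + 1 by exists (alpha %/ 4)%Z; move: ha; clear; lia.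
  have [y yE] : exists y, x = 2 * y by exists (x %/ 2)%Z; move: x2; clear; lia.
  have : p%:Z = 1 + 4 * (4 * m ^+ 2 + 2 * m + y ^+ 2) by rewrite px mE yE; ring.
  by move: (_ + y ^+ 2) (prime_gt0 pp) => u; clear; lia.
have oW w : w \in W -> odd w.1 by move=> /hW [].
have [g gP] := exists_primitive_root 'F_p; have h4 : (4 %| #|'F_p|.-1)%N by rewrite card_Fp.
have dP := primary_prodE oW dE; rewrite -/b in dP.
set P := \prod_(w <- W) _ in dP.
have P0 : (P%:~R : 'F_p) != 0.
  rewrite -(dvdz_pchar _ (pchar_Fp pp)) dvdzE absz_nat.
  have -> : `|P|%N = `|d|%N by rewrite dP abszM; case: (b); rewrite ?mul1n.
  rewrite dE big_seq; apply: (big_ind (fun u => ~~ (p %| u)%N)) => [|u v|w wW].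
  - by rewrite Euclid_dvd1.
  - by rewrite Euclid_dvdM // negb_or => -> ->.
  have [wp _ _ _] := hW w wW; rewrite Euclid_dvdX // negb_and dvdn_prime2 //.
  by apply/orP; left; apply: contraNneq pW => ->; apply: map_f.
have d0 : (d%:~R : 'F_p) != 0.
  by rewrite dP rmorphM mulf_neq0 //; case: (b); rewrite ?rmorphN ?oppr_eq0 oner_eq0.
have dl : dlog g (d%:~R : 'F_p) = ((if b then 0 else if (4 %| x)%Z then 0 else 2)
    + global_symbol k W (jac_re g) (jac_im g))%N %[mod 4].
  rewrite -[RHS]modnDmr -(dlog_primary_prod hW pp p4 gP pW) -/P modnDmr {1}dP.
  case: (b); first by rewrite mul1r add0n.
  rewrite rmorphM rmorphN1 (dlogM4 gP h4) ?oppr_eq0 ?oner_eq0 //.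
  by rewrite -modnDml (dlogN1_two_squares pp p4 gP px x2) modnDml.
have gW : all (fun w : nat * nat => ~~ (w.1 %| alpha ^+ 2 + x ^+ 2)%Z) W.
  apply/allP => w wW; rewrite -px dvdzE /=; have [wp _ _ _] := hW w wW.
  by rewrite dvdn_prime2 //; apply: contraNneq pW => <-; apply: map_f.
have p4' : (p%:Z = 1 %[mod 4])%Z by move: p4 (prime_gt0 pp); clear; lia.
have [B2 AB4] := jac_primary gP h4; have N := jac_norm_Fp pp p4 gP.
have a2 : ~~ (2 %| alpha)%Z by move: ha; clear; lia.
have A2 : ~~ (2 %| jac_re g)%Z.
  by move: AB4 B2 p4'; rewrite card_Fp //; clear; lia.
have [e1 e2] := two_squares_unique pp N (esym px) A2 B2 a2 x2.
have := global_symbol_conj hW gW e1 e2.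
have [t1 t2] := trace_criterion pp p4 gP ha px x2 d0.
move: dl; rewrite (fun_if (fun u => E_trace (4 * d) p == 2 * u)) t1 t2.
move: (dlog g _) (global_symbol k W (jac_re g) (jac_im g)) (global_symbol k W alpha x).
by case: (b); case: ifP; case: s {t1 t2 e1 e2}; clear => u v w /=; lia.
Qed.
End TraceSymbol.

(** * The constants of the conjecture *)

Definition HL_admissible (a b c : int) : Prop :=
  [/\ 0 < a, gcdz (gcdz a b) c = 1, ~ ((2 %| a + b)%Z /\ (2 %| c)%Z)
    & ~ (exists k : int, b ^+ 2 - 4 * a * c = k ^+ 2)].

(** If the constant were 0, the quotient in the conjecture would be constantly 0
    and could not tend to 1. *)
Lemma HL_delta_neq0 (R : realType) (a b c : int) :
  Hardy_Littlewood R -> HL_admissible a b c -> HL_delta R a b c != 0.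
Proof.
move=> HL [h1 h2 h3 h4]; apply/eqP => d0.
have := HL a b c h1 h2 h3 h4; rewrite d0.
under eq_fun do rewrite mul0r invr0 mulr0.
move/(cvg_lim (@Rhausdorff R)); rewrite lim_cst // => /eqP.
by rewrite eq_sym oner_eq0.
Qed.

(** The factor sqrt n / log n cancels.  The count in the denominator may vanish
    for small n, which the convention on division by 0 absorbs. *)
Lemma HL_ratio (R : realType) (a b c a' b' c' : int) :
  Hardy_Littlewood R -> HL_admissible a b c -> HL_admissible a' b' c' ->
  ((fun N => (HL_count a b c N.+1)%:R / (HL_count a' b' c' N.+1)%:R) @ \oo
    --> (HL_delta R a b c / HL_delta R a' b' c' : R))%classic.
Proof.
move=> HL h h'; have d0 := HL_delta_neq0 HL h; have d0' := HL_delta_neq0 HL h'.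
have [h1 h2 h3 h4] := h; have [h1' h2' h3' h4'] := h'.
have L := HL a b c h1 h2 h3 h4; have L' := HL a' b' c' h1' h2' h3' h4'.
pose dd := HL_delta R a b c / HL_delta R a' b' c'.
pose s n : R := Num.sqrt n%:R / ln n%:R.
have L3 : ((fun n => dd * (((HL_count a b c n)%:R / (HL_delta R a b c * s n)) *
    ((HL_count a' b' c' n)%:R / (HL_delta R a' b' c' * s n))^-1)) @ \oo --> dd)%classic.
  have dd1 : dd = dd * (1 * 1^-1) by rewrite invr1 !mulr1.
  rewrite [X in (_ --> X)%classic]dd1; apply: cvgMl_tmp; apply: (cvgM L).
  exact: (cvgV (oner_neq0 R) L').
rewrite (cvg_shiftS (fun n => (HL_count a b c n)%:R / (HL_count a' b' c' n)%:R : R)).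
apply: cvg_trans L3; apply: near_eq_cvg; near=> n.
have n2 : (2 <= n)%N by near: n; exact: nbhs_infty_ge.
have s0 : s n != 0.
  rewrite /s mulf_neq0 // ?invr_eq0.
    by rewrite gt_eqF // sqrtr_gt0 ltr0n; move: n2; case: (n).
  by rewrite gt_eqF // ln_gt0 // ltr1n.
rewrite /= [(_ / (_ * s n))^-1]invfM invrK /dd.
move: (s n) s0 (HL_count a b c n)%:R (HL_count a' b' c' n)%:R^-1 => u u0 v w.
by field; rewrite d0 d0' u0.
Unshelve. all: by end_near.
Qed.

Lemma legendreE (a : int) (p : nat) : prime p ->
  legendre a p = if (a%:~R : 'F_p) == 0 then 0
    else if [exists x : 'F_p, x ^+ 2 == a%:~R] then 1 else -1.
Proof.
move=> pp; have pK := pchar_Fp pp; rewrite /legendre (dvdz_pchar _ pK).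
case: eqP => // _; congr (if _ then 1 else -1); apply/existsP/existsP => -[x].
  rewrite eqz_mod_dvd (dvdz_pchar _ pK) rmorphB rmorphXn /= subr_eq0 => hx.
  by exists (x : nat)%:R.
move=> hx; exists (cast_ord (Fp_cast pp) x).
rewrite eqz_mod_dvd (dvdz_pchar _ pK) rmorphB rmorphXn /= subr_eq0 -[_%:~R]/(_%:R).
by rewrite natr_Zp.
Qed.

(** This makes the factors at the primes not dividing M the same for both
    quadratic polynomials: their discriminants differ by the factor M ^ 2. *)
Lemma legendre_sqrM (a b : int) (p : nat) : prime p -> ~~ (p %| b)%Z ->
  legendre (b ^+ 2 * a) p = legendre a p.
Proof.
move=> pp; rewrite (dvdz_pchar _ (pchar_Fp pp)) !legendreE // rmorphM rmorphXn /= => b0.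
rewrite mulf_eq0 expf_eq0 /= (negPf b0) /=; case: eqP => // _.
congr (if _ then 1 else -1); apply/existsP/existsP => -[x /eqP hx].
  exists (x / b%:~R); rewrite expr_div_n hx mulrAC divff ?mul1r //.
  by rewrite expf_neq0.
by exists (b%:~R * x); rewrite exprMn hx.
Qed.

Lemma legendreN1 (p : nat) : prime p -> odd p ->
  legendre (-1) p = if (p %% 4 == 1)%N then 1 else -1.
Proof.
move=> pp po; rewrite legendreE // rmorphN1 oppr_eq0 oner_eq0.
congr (if _ then 1 else -1); have cp := card_Fp pp; have p0 := prime_gt0 pp.
have two : (2 : 'F_p) != 0.
  by rewrite -(dvdn_pcharf (pchar_Fp pp)) dvdn_prime2 //; apply: contraTneq po => ->.
apply/existsP/eqP => [[x /eqP x2]|p1].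
  have xP := sqr_is_prim4 x2 two.
  have : (4 %| p.-1)%N.
    rewrite (prim_order_dvd xP); apply/eqP/(mulIf (x := x)).
      by rewrite (prim_root_neq0 xP).
    by rewrite mul1r -exprSr prednK // -[X in x ^+ X]cp expf_card.
  by move: p0; clear; lia.
have [g gP] := exists_primitive_root 'F_p; have h4 : (4 %| #|'F_p|.-1)%N.
  by rewrite cp; move: p1 p0; clear; lia.
exists (g ^+ (#|'F_p|.-1 %/ 4)); apply/eqP.
by rewrite (sqr_prim4 (quartic_root_prim4 gP h4)).
Qed.

Lemma tau1_gt0 (l : nat) : prime l -> odd l -> (0 < tau1 l)%N.
Proof.
move=> lp lo; have := odd_prime_gt2 lo lp; rewrite /tau1; case: ifP => _; lia.
Qed.

Section DeltaRatio.
Variables (R : realType) (alpha : int) (ls : seq nat).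
Hypotheses (a0 : alpha != 0) (lsP : all (fun l => prime l && odd l) ls)
  (lsu : uniq ls) (lsa : all (fun l : nat => ~~ (l %| alpha)%Z) ls).

Let M : nat := (4 * \prod_(l <- ls) l)%N.

Let leg (p : nat) : R := (legendre (- 4 * alpha ^+ 2) p)%:~R.

Lemma progression_modulus_gt0 : (0 < M)%N.
Proof.
rewrite muln_gt0 /= big_seq prodn_cond_gt0 // => l /(allP lsP) /andP [lp _].
exact: prime_gt0.
Qed.

Lemma prime_dvd_modulus (p : nat) : prime p -> odd p -> (p %| M)%N = (p \in ls).
Proof.
move=> pp po; rewrite Euclid_dvdM // -[4%N]/(2 ^ 2)%N Euclid_dvdX // andbT dvdn_prime2 //.
have -> /= : (p == 2)%N = false by apply: contraTF po => /eqP ->.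
elim: ls lsP => [_|l s IH /= /andP [/andP [lp lo] h]].
  by rewrite big_nil Euclid_dvd1.
by rewrite big_cons Euclid_dvdM // dvdn_prime2 // IH // inE.
Qed.

Lemma prod_odd_primes_modulus (f : nat -> R) (b : int) : (M %| b)%Z ->
  \prod_(p <- primes `|M%:Z ^+ 2|%N | (p %| b)%Z && (2 < p)%N) f p = \prod_(p <- ls) f p.
Proof.
move=> Mb; rewrite -big_filter; apply: perm_big; apply: uniq_perm => //.
  exact/filter_uniq/primes_uniq.
move=> p; rewrite mem_filter mem_primes abszX /= expn_gt0 progression_modulus_gt0 /=.
apply/idP/idP => [/andP [/andP [_ p2] /andP [pp]]|pl].
  have po : odd p by case: (even_prime pp) p2 => // ->.
  by rewrite Euclid_dvdX // andbT prime_dvd_modulus.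
have /andP [pp po] := allP lsP p pl; rewrite pp Euclid_dvdX // andbT prime_dvd_modulus // pl.
rewrite odd_prime_gt2 // !andbT; apply: dvdz_trans Mb.
by rewrite dvdzE /= prime_dvd_modulus.
Qed.

Lemma leg_ls (p : nat) : p \in ls -> leg p = if (p %% 4 == 1)%N then 1 else -1.
Proof.
move=> pl; have /andP [pp po] := allP lsP p pl; rewrite /leg.
have -> : - 4 * alpha ^+ 2 = (2 * alpha) ^+ 2 * (-1) by ring.
rewrite legendre_sqrM //; last first.
  rewrite dvdzE abszM /= Euclid_dvdM // negb_or dvdn_prime2 //.
  by rewrite (allP lsa p pl) andbT; apply: contraTneq po => ->.
by rewrite legendreN1 //; case: ifP.
Qed.

Let P1 (n : nat) : R := \prod_(3 <= p < n | prime p) (1 - leg p / (p%:R - 1)).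
Let PM (n : nat) : R :=
  \prod_(3 <= p < n | prime p && ~~ (p %| M%:Z ^+ 2)%Z) (1 - leg p / (p%:R - 1)).

Lemma HL_delta_two_squares : HL_delta R 1 0 (alpha ^+ 2) = limn P1.
Proof.
rewrite /HL_delta addr0 sqrtr1 divr1 big_nil !mulr1 mul1r.
apply: (congr1 (fun f : nat -> R => limn f)); apply: funext => n; apply: eq_big => [p|p pp].
  by rewrite dvdz1 /=; case: eqP => [->|]; rewrite ?andbT.
by rewrite (_ : 0 ^+ 2 - 4 * alpha ^+ 2 = - 4 * alpha ^+ 2) //; ring.
Qed.

Lemma HL_delta_progression (c : int) :
  HL_delta R (M%:Z ^+ 2) (2 * c * M%:Z) (c ^+ 2 + alpha ^+ 2)
  = 2 / M%:R * (\prod_(p <- ls) (p%:R / (p%:R - 1))) * limn PM.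
Proof.
rewrite /HL_delta prod_odd_primes_modulus ?dvdz_mull //; congr (_ * _ * _).
  have -> : gcdz 2 (M%:Z ^+ 2 + 2 * c * M%:Z) = 2.
    rewrite /gcdz; congr Posz; apply/gcdn_idPl; rewrite -[2%N]/`|2%:Z|%N -dvdzE.
    have -> : M%:Z ^+ 2 + 2 * c * M%:Z = (2 * (\prod_(l <- ls) l)%N%:Z * M%:Z + c * M%:Z) * 2.
      by rewrite /M PoszM; ring.
    by rewrite dvdz_mull.
  by rewrite rmorphXn /= sqrtr_sqr ger0_norm.
apply: (congr1 (fun f : nat -> R => limn f)); apply: funext => n; apply: eq_bigr => p /andP [pp pM].
rewrite (_ : (2 * c * M%:Z) ^+ 2 - _ = M%:Z ^+ 2 * (- 4 * alpha ^+ 2)); last by ring.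
rewrite legendre_sqrM //; apply: contraNN pM => pM.
by rewrite expr2 dvdz_mulr.
Qed.

Lemma euler_product_split (n : nat) : (M < n)%N ->
  P1 n = PM n * \prod_(p <- ls) (1 - leg p / (p%:R - 1)).
Proof.
move=> Mn; rewrite /P1 (bigID (fun p : nat => (p %| M%:Z ^+ 2)%Z)) /= mulrC.
congr (_ * _); rewrite -big_filter; apply: perm_big; apply: uniq_perm => //.
  by rewrite filter_uniq // iota_uniq.
move=> p; rewrite mem_filter mem_index_iota.
apply/idP/idP => [/andP [/andP [pp pM] /andP [p3 _]]|pl].
  rewrite -prime_dvd_modulus //; first by move: pM; rewrite dvdzE abszX Euclid_dvdX // andbT.
  by case: (even_prime pp) p3 => // ->.
have /andP [pp po] := allP lsP p pl; rewrite pp odd_prime_gt2 //=.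
have pM : (p %| M)%N by rewrite prime_dvd_modulus.
rewrite dvdzE abszX Euclid_dvdX // pM /=.
by apply: leq_ltn_trans Mn; apply: dvdn_leq; rewrite ?progression_modulus_gt0.
Qed.

(** The partial products for 1 and for M differ by the factors at the odd primes p that
    divide M, where p / (p - 1) divided by 1 - leg p / (p - 1) is p / tau1 p.  The
    product for M converges because its limit is nonzero while the limit of a
    divergent sequence is 0 by convention. *)
Lemma delta_ratio (c : int) : HL_delta R 1 0 (alpha ^+ 2) != 0 ->
  HL_delta R (M%:Z ^+ 2) (2 * c * M%:Z) (c ^+ 2 + alpha ^+ 2) != 0 ->
  HL_delta R (M%:Z ^+ 2) (2 * c * M%:Z) (c ^+ 2 + alpha ^+ 2)
   / HL_delta R 1 0 (alpha ^+ 2) = (2 * \prod_(l <- ls) (tau1 l)%:R)^-1.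
Proof.
rewrite HL_delta_two_squares HL_delta_progression => d1; rewrite mulf_eq0 negb_or => /andP [_ dM].
have cM : cvgn PM by exact: cvgNpoint.
have limE : limn P1 = limn PM * \prod_(p <- ls) (1 - leg p / (p%:R - 1)).
  apply: cvg_lim => //; apply: cvg_trans (cvgMr_tmp cM); apply: near_eq_cvg.
  by near=> n; rewrite /= euler_product_split //; near: n; exact: nbhs_infty_gt.
rewrite limE; move: d1; rewrite limE mulf_eq0 negb_or => /andP [_ F0].
rewrite invfM [(limn PM)^-1 * _]mulrC mulrACA divff // mulr1.
have M0 : (M%:R : R) = 4 * \prod_(l <- ls) l%:R by rewrite /M natrM natr_prod.
rewrite M0.
have PE : (\prod_(p <- ls) (p%:R / (p%:R - 1))) / \prod_(p <- ls) (1 - leg p / (p%:R - 1))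
   = (\prod_(l <- ls) l%:R) / \prod_(l <- ls) (tau1 l)%:R :> R.
  rewrite -!prodf_div; apply: eq_big_seq => p pl.
  have /andP [pp po] := allP lsP p pl; have p3 := odd_prime_gt2 po pp.
  have tE : (tau1 p)%:R = p%:R - 1 - leg p :> R.
    rewrite leg_ls // /tau1; have : (p %% 4 = 1 \/ p %% 4 = 3)%N by lia.
    case=> -> /=; last by ring.
    by rewrite natrB 1?ltnW //; ring.
  have t0 : (tau1 p)%:R != 0 :> R by rewrite pnatr_eq0 -lt0n tau1_gt0.
  have p1 : p%:R - 1 != 0 :> R by rewrite subr_eq0 (eqr_nat R p 1) gtn_eqF // ltnW.
  by rewrite tE; rewrite tE in t0; field; rewrite p1 t0.
have L0 : \prod_(l <- ls) l%:R != 0 :> R.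
  rewrite prodf_seq_neq0; apply/allP => l /(allP lsP) /andP [lp _] /=.
  by rewrite pnatr_eq0 -lt0n prime_gt0.
have T0 : \prod_(l <- ls) (tau1 l)%:R != 0 :> R.
  rewrite prodf_seq_neq0; apply/allP => l /(allP lsP) /andP [lp lo] /=.
  by rewrite pnatr_eq0 -lt0n tau1_gt0.
by rewrite -[LHS]mulrA PE; field; rewrite L0 T0.
Unshelve. all: by end_near.
Qed.
End DeltaRatio.

(** * Primes sorted by residue class *)

Lemma HL_admissible_two_squares (alpha : int) : alpha != 0 -> HL_admissible 1 0 (alpha ^+ 2).
Proof.
move=> a0; split=> //.
- by rewrite /gcdz /= !gcd1n.
- by rewrite addr0 dvdz1 => -[].
case=> k kE; have : 0 <= k ^+ 2 by rewrite sqr_ge0.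
have : 0 < alpha ^+ 2 by rewrite exprn_even_gt0.
by rewrite -kE; move: (alpha ^+ 2) => u; clear; lia.
Qed.

Lemma HL_admissible_residue (alpha : int) (ls : seq nat) (c : nat) :
  (alpha = 1 %[mod 4])%Z -> all (fun l => prime l && odd l) ls ->
  all (fun l : nat => ~~ (l %| alpha ^+ 2 + c%:Z ^+ 2)%Z) ls -> ~~ odd c ->
  let M := (4 * \prod_(l <- ls) l)%N in
  HL_admissible (M%:Z ^+ 2) (2 * c%:Z * M%:Z) (c%:Z ^+ 2 + alpha ^+ 2).
Proof.
move=> ha lsP lsc ce M; have M0 := progression_modulus_gt0 lsP; rewrite -/M in M0.
have o2 : ~~ (2 %| c%:Z ^+ 2 + alpha ^+ 2)%Z.
  have [m mE] : exists m, alpha = 4 * m + 1 by exists (alpha %/ 4)%Z; move: ha; clear; lia.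
  have [y yE] : exists y : nat, c = (2 * y)%N by exists (c %/ 2)%N; move: ce; clear; lia.
  have -> : c%:Z ^+ 2 + alpha ^+ 2 = 1 + 2 * (2 * y%:Z ^+ 2 + 8 * m ^+ 2 + 4 * m).
    by rewrite mE yE PoszM; ring.
  by move: (_ + 4 * m) => u; clear; lia.
split.
- by rewrite exprn_gt0 // ltz_nat.
- have cop : coprime M (absz (c%:Z ^+ 2 + alpha ^+ 2)).
    rewrite coprimeMl; apply/andP; split.
      rewrite -[4%N]/(2 ^ 2)%N coprimeXl // prime_coprime //.
    rewrite big_seq; apply: (big_ind (fun u => coprime u _)) => [|u v|l ll].
    + exact: coprime1n.
    + by rewrite coprimeMl => -> ->.
    have /andP [lp _] := allP lsP l ll; rewrite prime_coprime //.
    by have := allP lsc l ll; rewrite addrC.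
  rewrite /gcdz /=; congr Posz; apply/eqP; rewrite -[_ == _]/(coprime _ _).
  by apply: coprime_dvdl (dvdn_gcdl _ _) _; rewrite coprimeMl cop.
- by case=> _ h; rewrite h in o2.
have a0 : alpha != 0 by apply/eqP => a0; move: ha; rewrite a0.
case=> k kE; have : 0 <= k ^+ 2 by rewrite sqr_ge0.
have : 0 < M%:Z ^+ 2 * alpha ^+ 2.
  by rewrite mulr_gt0 ?exprn_even_gt0 //= -lt0n.
rewrite -kE (_ : _ - _ = - 4 * (M%:Z ^+ 2 * alpha ^+ 2)); last by ring.
by move: (M%:Z ^+ 2 * alpha ^+ 2) => u; clear; lia.
Qed.

Lemma card_Q (m : int) (N : nat) : #|Q m N| = HL_count 1 0 (m ^+ 2) N.+1.
Proof.
apply: eq_card => p; rewrite !inE; congr (_ && _); apply: asbool_equiv_eq; split.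
  by move=> [x ->]; exists `|x|%N; rewrite abszE -normrX ger0_norm ?sqr_ge0 //; ring.
by move=> [x ->]; exists x%:Z; ring.
Qed.

(** A prime alpha ^ 2 + y ^ 2 with y nonnegative determines y, hence the class of
    y modulo M, and belongs to the count of the polynomial (M x + c) ^ 2 + alpha ^ 2
    for this class c only. *)
Lemma card_residue_classes (alpha m D : int) (M N : nat) (C : pred nat) :
  (0 < M)%N -> m ^+ 2 = alpha ^+ 2 ->
  (forall (p y : nat), prime p -> p%:Z = alpha ^+ 2 + y%:Z ^+ 2 ->
    (~~ (p%:Z %| 2 * D)%Z && (E_trace D p == 2 * m)) = C (y %% M)%N) ->
  #|[set p in Q m N | ~~ (p%:Z %| 2 * D)%Z && (E_trace D p == 2 * m)]%SET| =
  (\sum_(c < M | C c)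
     HL_count (M%:Z ^+ 2) (2 * c%:Z * M%:Z) (c%:Z ^+ 2 + alpha ^+ 2) N.+1)%N.
Proof.
move=> M0 mE HC; rewrite /HL_count -sum1_card big_mkcond /=.
under [RHS]eq_bigr do rewrite -sum1_card big_mkcond /=.
rewrite exchange_big /=; apply: eq_bigr => p _; rewrite !inE mE.
under [RHS]eq_bigr do rewrite inE.
have [pp|np] /= := boolP (prime p); last by rewrite big1.
have formE (c : nat) :
  (exists x : nat, p%:Z = M%:Z ^+ 2 * x%:Z ^+ 2 + 2 * c%:Z * M%:Z * x%:Z
      + (c%:Z ^+ 2 + alpha ^+ 2)) <->
  (exists x : nat, p%:Z = alpha ^+ 2 + (M * x + c)%N%:Z ^+ 2).
  by split=> -[x ->]; exists x; rewrite PoszD PoszM; ring.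
case: asboolP => [[x xE]|nx] /=; last first.
  rewrite big1 // => c _; case: asboolP => // /formE [x xE]; exfalso; apply: nx.
  by exists (M * x + c)%N%:Z.
have yE : p%:Z = alpha ^+ 2 + `|x|%N%:Z ^+ 2.
  by rewrite abszE -normrX ger0_norm ?sqr_ge0.
move: (`|x|%N) yE => y yE {x xE}; rewrite (HC p y pp yE).
pose c0 := Ordinal (ltn_pmod y M0).
rewrite (eq_bigr (fun c => if c == c0 then 1%N else 0%N)) => [|c Cc].
  rewrite -big_mkcondr; case: ifP => Cy.
    by rewrite (bigD1 c0) /= ?Cy ?eqxx // big1 // => c /andP [/andP [_ ->]].
  by rewrite big1 // => c /andP [Cc /eqP cE]; move: Cc; rewrite cE /= Cy.
congr (if _ then _ else _); apply/asboolP/eqP => [/formE [x xE]|cE].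
  have E : (M * x + c)%N%:Z ^+ 2 = y%:Z ^+ 2 by apply: (addrI (alpha ^+ 2)); rewrite -xE -yE.
  have := congr1 absz E; rewrite !abszX /= => /eqP; rewrite eqn_exp2r // => /eqP yx.
  by apply: val_inj; rewrite /= -yx mulnC modnMDl modn_small.
apply/formE; exists (y %/ M)%N; rewrite yE; congr (_ + _%:Z ^+ 2).
by rewrite cE /= mulnC -divn_eq.
Qed.

(** * The density as a number of residue classes *)

Section Density.
Variable k : nat -> int -> int -> nat.
Variables (alpha d : int) (W : seq (nat * nat)) (s : bool).
Hypotheses (ha : (alpha = 1 %[mod 4])%Z) (hW : symbols_for k alpha W)
  (uW : uniq (map fst W)) (posW : forall w, w \in W -> (0 < w.2)%N)
  (d2 : (2 %| d)%Z = false) (dE : `|d|%N = (\prod_(w <- W) w.1 ^ w.2)%N).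

Let M : nat := (4 * modulus W)%N.
Let b := (d %% 4 == 1)%Z.
Let m : int := if s then - alpha else alpha.

Definition class_selected (c : nat) : bool :=
  [&& good_residue alpha W c, ~~ odd c
    & (global_symbol k W alpha c ==
         (if (4 %| c)%N then 2 * s else 2 * (b (+) s))%N %[mod 4])%N].

Lemma class_modulus_gt0 : (0 < M)%N.
Proof. by rewrite muln_gt0 (modulus_gt0 hW). Qed.

Lemma dvdn_modulus (w : nat * nat) : w \in W -> (w.1 %| M)%N.
Proof.
by move=> wW; rewrite dvdn_mull // /modulus (big_rem w wW) dvdn_mulr.
Qed.

(** Odd y gives p = 2, and a prime p that divides M is excluded by
    [good_residue]; both are bad primes.  Otherwise [trace_symbol] applies. *)
Lemma class_selectedP (p y : nat) : prime p -> p%:Z = alpha ^+ 2 + y%:Z ^+ 2 ->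
  (~~ (p%:Z %| 2 * (4 * d))%Z && (E_trace (4 * d) p == 2 * m)) = class_selected (y %% M).
Proof.
move=> pp pE; rewrite /class_selected.
have ym w : w \in W -> ((y %% M)%N%:Z = y%:Z %[mod w.1])%Z.
  by move=> wW; rewrite !modz_nat (modn_dvdm _ (dvdn_modulus wW)).
have -> : good_residue alpha W (y %% M)%N = good_residue alpha W y.
  apply: eq_in_all => w wW; congr (~~ _); exact: dvdz_norm_mod (ym w wW).
have -> : global_symbol k W alpha (y %% M)%N = global_symbol k W alpha y.
  apply: eq_big_seq => w wW; have [_ _ _ ls] := hW wW; congr (_ * _)%N.
  exact: (symbol_mod ls alpha (ym w wW)).
have M4 : (4 %| M)%N by rewrite dvdn_mulr.
have -> : (4 %| y %% M)%N = (4 %| y)%N by rewrite /dvdn modn_dvdm.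
have -> : odd (y %% M) = odd y.
  by rewrite odd_mod //; apply: negbTE; rewrite -dvdn2; apply: dvdn_trans M4.
have [oy|ey] /= := boolP (odd y).
  rewrite andbF; apply/negbTE; rewrite negb_and negbK; apply/orP; left.
  have p2 : p = 2%N.
    apply/eqP; rewrite eq_sym -dvdn_prime2 //.
    have : (2 %| alpha ^+ 2 + y%:Z ^+ 2)%Z.
      have [u uE] : exists u, alpha = 2 * u + 1 by exists (alpha %/ 2)%Z; move: ha; clear; lia.
      have [v vE] : exists v, y%:Z = 2 * v + 1 by exists (y%:Z %/ 2)%Z; move: oy; clear; lia.
      rewrite uE vE (_ : _ + _ = (2 * u ^+ 2 + 2 * u + 1 + 2 * v ^+ 2 + 2 * v) * 2); last by ring.
      by rewrite dvdz_mull.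
    by rewrite -pE dvdzE.
  by rewrite p2 dvdz_mulr.
have x2 : (2 %| y%:Z)%Z by move: ey; clear; lia.
have gE : good_residue alpha W y = (p \notin map fst W).
  rewrite /good_residue -pE; apply/allP/idP => [h|h w wW].
    by apply/mapP => -[w wW pw]; have := h w wW; rewrite pw dvdzE /= dvdnn.
  have [wp _ _ _] := hW wW; rewrite dvdzE /= dvdn_prime2 //.
  by apply: contraNneq h => <-; apply: map_f.
have po : odd p.
  have [u uE] : exists u, alpha = 2 * u + 1 by exists (alpha %/ 2)%Z; move: ha; clear; lia.
  have [v vE] : exists v, y%:Z = 2 * v by exists (y%:Z %/ 2)%Z; move: ey; clear; lia.
  have : p%:Z = 1 + 2 * (2 * u ^+ 2 + 2 * u + 2 * v ^+ 2) by rewrite pE uE vE; ring.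
  by move: (_ + 2 * v ^+ 2) => z; clear; lia.
have dvdE : (p%:Z %| 2 * (4 * d))%Z = (p \in map fst W).
  rewrite dvdzE !abszM /= !Euclid_dvdM // dE.
  have -> : (p %| 2)%N = false.
    by rewrite dvdn_prime2 //; apply: contraTF po => /eqP ->.
  have -> /= : (p %| 4)%N = false.
    rewrite -[4%N]/(2 ^ 2)%N Euclid_dvdX // dvdn_prime2 // andbT.
    by apply: contraTF po => /eqP ->.
  elim: W hW posW => [|w V IH] hV pV; first by rewrite big_nil Euclid_dvd1.
  have [wp _ _ _] := hV w (mem_head _ _).
  rewrite big_cons Euclid_dvdM // Euclid_dvdX // pV ?mem_head // andbT dvdn_prime2 //.
  rewrite IH ?inE // => v vV; [apply: hV | apply: pV]; by rewrite inE vV orbT.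
rewrite gE dvdE; have [//|pW] /= := boolP (p \in map fst W).
by rewrite (trace_symbol ha s hW pp pE x2 d2 dE pW).
Qed.

(** Each class contributes the same limit, given by [delta_ratio]. *)
Lemma has_dens_symbol (R : realType) : Hardy_Littlewood R ->
  has_dens (4 * d) m ((\sum_(c < M | class_selected c) 1)%N%:R
     * (2 * \prod_(w <- W) (tau1 w.1)%:R)^-1 : R).
Proof.
move=> HL; have a0 : alpha != 0 by apply/eqP => a0; move: ha; rewrite a0.
have mE : m ^+ 2 = alpha ^+ 2 by rewrite /m; case: s; rewrite ?sqrrN.
rewrite /has_dens.
under eq_fun do rewrite (card_residue_classes _ class_modulus_gt0 mE class_selectedP) card_Q mE
  natr_sum mulr_suml.
rewrite natr_sum mulr_suml; apply: cvg_big => [|c]; first exact: add_continuous.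
move: (nat_of_ord c) => {}c sel.
have lsP : all (fun l => prime l && odd l) (map fst W).
  by apply/allP => l /mapP [w wW ->]; have [-> ->] := hW wW.
have lsa : all (fun l : nat => ~~ (l %| alpha)%Z) (map fst W).
  by apply/allP => l /mapP [w wW ->]; have [_ _ ->] := hW wW.
have ME : M = (4 * \prod_(l <- map fst W) l)%N by rewrite big_map.
have h1 := HL_admissible_two_squares a0.
have hM : HL_admissible (M%:Z ^+ 2) (2 * c%:Z * M%:Z) (c%:Z ^+ 2 + alpha ^+ 2).
  have /and3P [g ec _] := sel; rewrite ME; apply: HL_admissible_residue => //.
  by apply/allP => l /mapP [w wW ->]; apply: (allP g).
have hM' := hM; rewrite ME in hM'.
have := delta_ratio a0 lsP uW lsa (HL_delta_neq0 HL h1) (HL_delta_neq0 HL hM').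
by rewrite -ME big_map mul1r => <-; apply: HL_ratio.
Qed.
End Density.

(** * Evaluation of the density *)

Lemma tau_prod (s : seq nat) : all prime s -> uniq s ->
  tau (\prod_(p <- s) p)%N = (\prod_(p <- s) tau1 p)%N.
Proof.
move=> sP su; rewrite /tau; apply: perm_big; apply: uniq_perm => //.
  exact: primes_uniq.
move=> p; rewrite mem_primes.
have -> : (0 < \prod_(p <- s) p)%N.
  by rewrite big_seq prodn_cond_gt0 // => q /(allP sP); exact: prime_gt0.
apply/andP/idP => [[pp /=]|ps]; last first.
  by rewrite (allP sP p ps) (big_rem p ps) dvdn_mulr.
elim: s sP {su} => [|q s IH] /=; first by rewrite big_nil Euclid_dvd1.
move=> /andP [qP sP]; rewrite big_cons Euclid_dvdM // dvdn_prime2 // inE.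
by case/orP => [-> //|/IH -> //]; rewrite orbT.
Qed.

Lemma prod_local_sum_odd (s : seq nat) j : odd j ->
  \prod_(l <- s) local_sum l j = (-1) ^+ (count8 1 s + count8 7 s)%N.
Proof.
move=> oj; elim: s => [|l s IH]; first by rewrite big_nil.
rewrite big_cons IH /count8 /= /local_sum.
have -> : (4 %| j)%N = false by apply: contraTF oj => /dvdnP [i ->]; rewrite oddM andbF.
rewrite dvdn2 oj /= !inE; move: (l %% 8)%N => r; rewrite -[(1 %% 8)%N]/1%N -[(7 %% 8)%N]/7%N.
case: (r =P 1%N) => [-> | _]; first by rewrite add0n addSn exprS.
by case: (r =P 7%N) => _; rewrite ?add0n ?mul1r // addnCA addSn exprS.
Qed.

Lemma prod_local_sum_2mod4 (s : seq nat) j : (j %% 4 = 2)%N ->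
  \prod_(l <- s) local_sum l j = (-1) ^+ size s.
Proof.
move=> j2; elim: s => [|l s IH]; first by rewrite big_nil.
rewrite big_cons IH /local_sum /= exprS /dvdn j2 /=.
by rewrite (_ : (j %% 2)%N = 0%N) //; move: j2; clear; lia.
Qed.

Lemma prod_local_sum_0mod4 (s : seq nat) j : (4 %| j)%N ->
  \prod_(l <- s) local_sum l j = (\prod_(l <- s) tau1 l)%N%:Z.
Proof.
move=> j0; elim: s => [|l s IH]; first by rewrite !big_nil.
by rewrite !big_cons IH /local_sum j0 PoszM.
Qed.

(** The factorization of the odd part of D. *)
Definition exponent_list (ps qs ls : seq nat) : seq (nat * nat) :=
  [seq (l, 1%N) | l <- ps] ++ [seq (l, 2) | l <- qs] ++ [seq (l, 3) | l <- ls].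

Lemma map_fst_exponent_list ps qs ls : map fst (exponent_list ps qs ls) = ps ++ qs ++ ls.
Proof. by rewrite /exponent_list !map_cat -!map_comp !map_id. Qed.

Lemma big_exponent_list (R : Type) (idx : R) (op : Monoid.law idx) (F : nat * nat -> R)
    (ps qs ls : seq nat) :
  \big[op/idx]_(w <- exponent_list ps qs ls) F w =
  op (\big[op/idx]_(p <- ps) F (p, 1%N))
     (op (\big[op/idx]_(q <- qs) F (q, 2)) (\big[op/idx]_(l <- ls) F (l, 3))).
Proof. by rewrite /exponent_list !big_cat !big_map. Qed.

Section Assembly.
Variables (R : realType) (alpha d : int) (ps qs ls : seq nat).
Hypotheses (HL : Hardy_Littlewood R) (ha : (alpha = 1 %[mod 4])%Z)
  (hprimes : all (fun p => prime p && odd p) (ps ++ qs ++ ls))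
  (huniq : uniq (ps ++ qs ++ ls))
  (dE : `|d|%N = (\prod_(p <- ps) p * ((\prod_(q <- qs) q) ^ 2 * (\prod_(l <- ls) l) ^ 3))%N)
  (dalpha : gcdz d alpha = 1).

Let W := exponent_list ps qs ls.
Let T : R := (\prod_(l <- ps ++ qs ++ ls) (tau1 l)%:R).
Let e1 := (count8 1 ps + count8 7 ps + size qs + count8 1 ls + count8 7 ls)%N.

(** The terms j = 0, 2 of [count_global_symbol] give 1 and the quotient by tau of
    the primes of odd exponent; the terms j = 1, 3 are equal to each other, and
    when d is 1 modulo 4 the contributions of the classes 0 and 2 modulo 4 to each
    of them cancel. *)
Lemma dens_value (s : bool) : 
  has_dens (4 * d) (if s then - alpha else alpha)
   (4^-1 * (1 + (-1) ^+ (size ps + size ls) / (\prod_(l <- ps ++ ls) (tau1 l)%:R)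
     + (if (d %% 4 == 1)%Z then 0 else (-1) ^+ s * 2 * (-1) ^+ e1 / T)) : R).
Proof.
have dW : `|d|%N = (\prod_(w <- W) w.1 ^ w.2)%N.
  have pw n r : ((\prod_(p <- r) p) ^ n = \prod_(p <- r) p ^ n)%N.
    exact: (big_morph (expn^~ n) (fun x y => expnMn x y n) (exp1n n)).
  by rewrite dE !pw big_exponent_list.
have [k kP] : exists k, forall l, prime l -> odd l -> local_symbol l (k l).
  have H l : exists f, prime l -> odd l -> local_symbol l f.
    have [lp|lp] := boolP (prime l); last by exists (fun _ _ => 0%N).
    have [lo|lo] := boolP (odd l); last by exists (fun _ _ => 0%N).
    by have [f fP] := exists_local_symbol lp lo; exists f.
  by have [k kP] := choice H; exists k.
have mW w : w \in W -> w.1 \in ps ++ qs ++ ls.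
  by move=> wW; rewrite -map_fst_exponent_list; apply: map_f.
have posW w : w \in W -> (0 < w.2)%N.
  by rewrite !mem_cat => /or3P [] /mapP [l _ ->].
have dvW w : w \in W -> (w.1 %| d)%Z.
  move=> wW; rewrite dvdzE dW (big_rem w wW) /= dvdn_mulr //.
  by rewrite dvdn_exp // posW.
have hW : symbols_for k alpha W.
  move=> w wW; have /andP [wp wo] := allP hprimes _ (mW w wW).
  split=> //; last exact: kP.
  apply/negP => wa; have : (w.1 %| gcdz d alpha)%Z by rewrite dvdz_gcd dvW.
  by rewrite dalpha dvdz1 /=; move: wp; case: eqP => // ->.
have uW : uniq (map fst W) by rewrite map_fst_exponent_list.
have d2 : (2 %| d)%Z = false.
  rewrite dvdzE dW; apply/negbTE; rewrite big_seq; apply: (big_ind (fun u => ~~ (2 %| u)%N)) => //.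
    by move=> u v; rewrite Euclid_dvdM // negb_or => -> ->.
  move=> w wW; have /andP [wp wo] := allP hprimes _ (mW w wW).
  by rewrite Euclid_dvdX // negb_and dvdn2 wo.
have := has_dens_symbol (s := s) ha hW uW posW d2 dW HL.
have := count_global_symbol s ((d %% 4 == 1)%Z (+) s) hW uW.
set X := fun j => _; set N := (\sum_(c < _ | _) _)%N => NE.
have -> : (\sum_(c < 4 * modulus W | class_selected k alpha d W s c) 1)%N = N.
  rewrite /N [RHS]big_mkcond [LHS]big_mkcond; apply: eq_bigr => c _.
  by rewrite /class_selected andbA; case: (_ && ~~ _) => //=; case: eqP.
pose T0 r := (\prod_(l <- r) tau1 l)%N%:Z.
have XE j : X j = (\prod_(l <- ps) local_sum l j) * ((\prod_(l <- qs) local_sum l (j * 2))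
    * \prod_(l <- ls) local_sum l (j * 3)).
  by rewrite /X /W big_exponent_list /=; under eq_bigr do rewrite muln1.
have X0 : X 0%N = T0 ps * (T0 qs * T0 ls) by rewrite XE !prod_local_sum_0mod4.
have X1 : X 1%N = (-1) ^+ e1.
  rewrite XE (prod_local_sum_odd ps) // (prod_local_sum_odd ls) //
    (prod_local_sum_2mod4 qs) // -!exprD.
  by congr (_ ^+ _); rewrite /e1; clear; lia.
have X2 : X 2 = (-1) ^+ (size ps + size ls) * T0 qs.
  rewrite XE (prod_local_sum_2mod4 ps) // (prod_local_sum_2mod4 ls) //
    (prod_local_sum_0mod4 qs) // exprD; ring.
have X3 : X 3 = (-1) ^+ e1.
  rewrite XE (prod_local_sum_odd ps) // (prod_local_sum_odd ls) //
    (prod_local_sum_2mod4 qs) // -!exprD.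
  by congr (_ ^+ _); rewrite /e1; clear; lia.
have T0E r : (T0 r)%:~R = \prod_(l <- r) (tau1 l)%:R :> R.
  by rewrite /T0 -[_%:~R]/(_%:R) natr_prod.
have T_neq0 r : {subset r <= ps ++ qs ++ ls} -> \prod_(l <- r) (tau1 l)%:R != 0 :> R.
  move=> rs; rewrite prodf_seq_neq0; apply/allP => l /rs /(allP hprimes) /andP [lp lo] /=.
  by rewrite pnatr_eq0 -lt0n tau1_gt0.
have tp : \prod_(l <- ps) (tau1 l)%:R != 0 :> R.
  by apply: T_neq0 => l lr; rewrite mem_cat lr.
have tq : \prod_(l <- qs) (tau1 l)%:R != 0 :> R.
  by apply: T_neq0 => l lr; rewrite !mem_cat lr orbT.
have tl : \prod_(l <- ls) (tau1 l)%:R != 0 :> R.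
  by apply: T_neq0 => l lr; rewrite !mem_cat lr !orbT.
have -> : \prod_(w <- W) (tau1 w.1)%:R = T.
  by rewrite /T -map_fst_exponent_list big_map.
have := congr1 (intr : int -> R) NE.
rewrite !big_ord_recl big_ord0 /= /bump /= X0 X1 X2 X3 => NR hd.
apply: (eq_ind _ (fun x => has_dens (4 * d) (if s then - alpha else alpha) x) hd).
have -> : N%:R = (4 * N%:Z)%:~R / 4 :> R by rewrite rmorphM /=; field.
rewrite NR !(rmorphM, rmorphD, rmorphXn, rmorphN1, rmorph0, rmorph1) /= !T0E /T !big_cat /=.
move: ((-1) ^+ e1) ((-1) ^+ (size ps + size ls)) => u v.
move: (\prod_(l <- ps) _) (\prod_(l <- qs) _) (\prod_(l <- ls) _) tp tq tl => x y z x0 y0 z0.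
by case: (d %% 4 == 1)%Z; case: (s); rewrite /= ?mul0n ?muln0 ?muln1 ?expr0 ?expr1; field;
  rewrite x0 y0 z0.
Qed.
End Assembly.

Theorem theorem3p8 (R : realType) (HL : Hardy_Littlewood R)
  (alpha D : int) (eps : bool) (sigma : nat) (ps qs ls : seq nat)
  (halpha : (alpha = 1 %[mod 4])%Z)
  (hsigma : (sigma <= 3)%N)
  (hprimes : all (fun p => prime p && odd p) (ps ++ qs ++ ls))
  (huniq : uniq (ps ++ qs ++ ls))
  (hD : D = (-1) ^+ eps * 2 ^+ sigma * \prod_(p <- ps) p%:Z
            * (\prod_(q <- qs) q%:Z) ^+ 2 * (\prod_(l <- ls) l%:Z) ^+ 3)
  (hgcd : gcdz D alpha = 1)
  (h4D : (4 %| D)%Z /\ ~ (8 %| D)%Z) :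
  let r := size ps in
  let s := size qs in
  let t := size ls in
  let r_ i := count8 i ps in
  let t_ i := count8 i ls in
  let pp := (\prod_(p <- ps) p)%N in
  let qq := (\prod_(q <- qs) q)%N in
  let ll := (\prod_(l <- ls) l)%N in
  (((D %/ 4)%Z = 3 %[mod 4])%Z ->
     has_dens D alpha
       (4^-1 * (1 + (-1) ^+ (r + t) / (tau (pp * ll))%:R
                + 2 * (-1) ^+ (r_ 1 + r_ 7 + s + t_ 1 + t_ 7)%N
                  / (tau (pp * qq * ll))%:R) : R)
     /\
     has_dens D (- alpha)
       (4^-1 * (1 + (-1) ^+ (r + t) / (tau (pp * ll))%:R
                - 2 * (-1) ^+ (r_ 1 + r_ 7 + s + t_ 1 + t_ 7)%N
                  / (tau (pp * qq * ll))%:R) : R))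
  /\
  (((D %/ 4)%Z = 1 %[mod 4])%Z ->
     has_dens D alpha
       (4^-1 * (1 + (-1) ^+ (r + t) / (tau (pp * ll))%:R) : R)
     /\
     has_dens D (- alpha)
       (4^-1 * (1 + (-1) ^+ (r + t) / (tau (pp * ll))%:R) : R)).
Proof.
move=> r s t r_ t_ pp qq ll.
pose d : int := (-1) ^+ eps * \prod_(p <- ps) p%:Z
   * (\prod_(q <- qs) q%:Z) ^+ 2 * (\prod_(l <- ls) l%:Z) ^+ 3.
have Pz (u : seq nat) : \prod_(p <- u) p%:Z = (\prod_(p <- u) p)%N%:Z.
  by rewrite (big_morph Posz PoszM (erefl _)).
have dE : `|d|%N = (pp * (qq ^ 2 * ll ^ 3))%N.
  by rewrite /d !Pz !abszM !abszX /= exp1n mul1n -/pp -/qq -/ll; ring.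
have od : (2 %| d)%Z = false.
  have on u : {subset u <= ps ++ qs ++ ls} -> odd (\prod_(p <- u) p).
    move=> us; rewrite big_seq; apply: (big_ind odd) => // [x y|l /us lu].
      by rewrite oddM => -> ->.
    by have /andP [] := allP hprimes l lu.
  rewrite dvdzE dE dvdn2 !oddM /= /pp /qq /ll !on //.
  - by move=> l lu; rewrite !mem_cat lu !orbT.
  - by move=> l lu; rewrite !mem_cat lu orbT.
  - by move=> l lu; rewrite mem_cat lu.
have D4 : D = 4 * d.
  have DE : D = 2 ^+ sigma * d by rewrite hD /d; ring.
  case: h4D; rewrite DE; move: hsigma od; clear.
  case: sigma => [|[|[|[|//]]]] _ od; rewrite ?expr0 ?expr1 ?mul1r //.
  - by move: od; clear; lia.
  - by move: od; clear; lia.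
  - by move=> _ []; apply: dvdz_mulr.
have dal : gcdz d alpha = 1.
  have : (gcdz d alpha %| gcdz D alpha)%Z.
    by rewrite dvdz_gcd dvdz_gcdr andbT D4 dvdz_mull // dvdz_gcdl.
  by rewrite hgcd dvdz1 /gcdz /= => /eqP ->.
have -> : (D %/ 4)%Z = d by rewrite D4 mulKz.
have primeP u : {subset u <= ps ++ qs ++ ls} -> all prime u.
  by move=> us; apply/allP => l /us /(allP hprimes) /andP [].
have tau1E : (tau (pp * ll))%:R = \prod_(l <- ps ++ ls) (tau1 l)%:R :> R.
  rewrite /pp /ll -big_cat tau_prod ?natr_prod //.
    by apply: primeP => l; rewrite !mem_cat => /orP [] ->; rewrite ?orbT.
  move: huniq; rewrite !cat_uniq has_cat negb_or.
  by case/and3P=> -> /andP [_ ->] /and3P [_ _ ->].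
have tau2E : (tau (pp * qq * ll))%:R = \prod_(l <- ps ++ qs ++ ls) (tau1 l)%:R :> R.
  rewrite /pp /ll /qq -mulnA -!big_cat tau_prod ?natr_prod //.
  exact: primeP.
have H b := dens_value HL halpha hprimes huniq dE dal b.
have H0 := H false; have H1 := H true; rewrite /= -D4 in H0 H1.
rewrite tau1E tau2E.
split=> dm.
  have db : (d %% 4 == 1)%Z = false by move: dm; clear; lia.
  rewrite db in H0 H1; split.
    by move: H0; rewrite expr0 mul1r.
  by move: H1; rewrite expr1 mulN1r !mulNr.
have db : (d %% 4 == 1)%Z by move: dm; clear; lia.
by rewrite db !addr0 in H0 H1; split.
Qed.
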